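(* Let $F \in \mathbb{R}[x_1, \ldots, x_n]$ be a homogeneous form of degree $d > 1$ satisfying $n - \dim V_F^* > 4$. Let $\theta_j \le \theta_j'$ $(1 \le j \le n)$ be real numbers. Suppose $\mathbf{x}_0 \in (0,1)^n$ satisfies $F(\mathbf{x}_0) = 0$ and is non-singular, i.e. $\nabla F(\mathbf{x}_0) \neq \mathbf{0}$. Let $\varpi : \mathbb{R}^n \to \mathbb{R}$ be a smooth function whose support is contained in $\mathbf{x}_0 + [-\delta_0, \delta_0]^n$ for some $\delta_0 > 0$. Then, provided $\delta_0$ is sufficiently small, there is a constant $C > 0$ (which may depend on $F$, $\mathbf{x}_0$, $\varpi$, $\delta_0$ and the $\theta_j, \theta_j'$) such that for all $\tau \in \mathbb{R}$, all $\mathbf{r} = (r_1, \ldots, r_n) \in [\theta_1, \theta_1'] \times \cdots \times [\theta_n, \theta_n']$ and all $\mathbf{t} = (t_1, \ldots, t_n) \in \mathbb{R}^n$, $$\Big| \int_0^\infty \cdots \int_0^\infty \varpi(\mathbf{x})\, x_1^{r_1 + i t_1} \cdots x_n^{r_n + i t_n}\, e^{2\pi i \tau F(\mathbf{x})}\, d\mathbf{x} \Big| \le C \min\{1, |\tau|^{-1}\},$$ where $\min\{1,|\tau|^{-1}\}$ is interpreted as $1$ when $\tau = 0$. In particular $C$ is independent of $\tau$, $\mathbf{r}$ and $\mathbf{t}$.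
   Context: $V_F^* = \{\mathbf{z} \in \mathbb{C}^n : \nabla F(\mathbf{z}) = \mathbf{0}\}$ is the singular locus of $V(F) = \{\mathbf{z} \in \mathbb{C}^n : F(\mathbf{z}) = 0\}$, regarded as an affine variety in $\mathbb{A}^n_{\mathbb{C}}$, and $\dim V_F^*$ is its dimension. For $x > 0$ and $s \in \mathbb{C}$, $x^{s} = e^{s \log x}$. *)

(* Defs.v *)
From HB Require Import structures.
From mathcomp Require Import all_boot all_order all_algebra.
(* mpoly must be Imported before the analysis libraries: in the other order
   their notations clash. *)
From mathcomp Require Import mpoly.
From mathcomp Require Import complex.
From mathcomp Require Import all_classical all_reals all_analysis.

Set Implicit Arguments.
Unset Strict Implicit.
Unset Printing Implicit Defensive.

Import Order.TTheory GRing.Theory Num.Theory.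
Import numFieldNormedType.Exports.

Local Open Scope classical_set_scope.
Local Open Scope ring_scope.
Local Open Scope complex_scope.

Section AffineDimension.
Context {R : realType} {n : nat}.
Local Notation C := R[i].
Implicit Types (V Z : set 'rV[C]_n).

Definition zero_locus (S : set {mpoly C[n]}) : set 'rV[C]_n :=
  [set z | forall p, S p -> p.@[z ord0] = 0].

Definition zariski_closed Z := exists S, Z = zero_locus S.

Definition irreducible_closed Z :=
  [/\ zariski_closed Z, Z !=set0 &
      forall A B, zariski_closed A -> zariski_closed B ->
        Z = A `|` B -> Z = A \/ Z = B].

Definition irreducible_chain V (k : nat) (W : nat -> set 'rV[C]_n) :=
  (forall i, (i <= k)%N -> irreducible_closed (W i) /\ W i `<=` V) /\
  (forall i, (i < k)%N -> W i `<` W i.+1).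

(* Krull dimension of a closed V; -oo when V is empty *)
Definition affine_dim V : \bar R :=
  ereal_sup [set (k%:R)%:E | k in [set k | exists W, irreducible_chain V k W]].

Definition singular_locus (F : {mpoly R[n]}) : set 'rV[C]_n :=
  [set z | forall i, (map_mpoly (real_complex R) F)^`M(i).@[z ord0] = 0].

End AffineDimension.

Section Smooth.
Context {R : realType} {n : nat}.

Definition partial (j : 'I_n) (f : 'rV[R]_n -> R) : 'rV[R]_n -> R :=
  fun x => 'D_(delta_mx ord0 j) f x.

Definition iter_partial (s : seq 'I_n) (f : 'rV[R]_n -> R) : 'rV[R]_n -> R :=
  foldr partial f s.

Definition smooth (f : 'rV[R]_n -> R) :=
  forall s : seq 'I_n,
    continuous (iter_partial s f) /\
    forall (j : 'I_n) x, derivable (iter_partial s f) x (delta_mx ord0 j).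

Definition fsupport (f : 'rV[R]_n -> R) : set 'rV[R]_n :=
  closure [set x | f x != 0].

Definition cube (x0 : 'rV[R]_n) (delta : R) : set 'rV[R]_n :=
  [set x | forall j, `|x ord0 j - x0 ord0 j| <= delta].

End Smooth.

Section ComplexIntegral.
Context {R : realType}.
Local Notation C := R[i].

Definition cexp (z : C) : C :=
  (expR (complex.Re z))%:C * (cos (complex.Im z) +i* sin (complex.Im z)).

(* meaningful for x > 0 only *)
Definition cpow (x : R) (s : C) : C := cexp (s * (ln x)%:C).

(* The iterated integral over x_1, ..., x_n in ]0, +oo[; x_1 is outermost. *)
Fixpoint iter_integral (n : nat) : ('rV[R]_n -> R) -> R :=
  match n with
  | 0 => fun f => f 0
  | m.+1 => fun f =>
      \int[lebesgue_measure]_(x in `]0%R, +oo[)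
        iter_integral (fun v : 'rV[R]_m => f (row_mx (x%:M : 'rV_1) v))
  end.

Definition iter_cintegral (n : nat) (f : 'rV[R]_n -> C) : C :=
  iter_integral (fun x => complex.Re (f x)) +i*
  iter_integral (fun x => complex.Im (f x)).

Definition oscillatory_integrand (n : nat) (F : {mpoly R[n]})
    (varpi : 'rV[R]_n -> R) (tau : R) (r t : 'I_n -> R) (x : 'rV[R]_n) : C :=
  (varpi x)%:C * (\prod_(j < n) cpow (x ord0 j) (r j +i* t j)) *
  cexp ((2 * pi * tau * F.@[x ord0])%:C * 'i).

(* min {1, |tau|^-1}, equal to 1 at tau = 0 (where tau^-1 is 0 here) *)
Definition min1inv (tau : R) : R :=
  if tau == 0 then 1 else Num.min 1 `|tau|^-1.

End ComplexIntegral.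

(* Main.v *)
Require Import Defs.
From HB Require Import structures.
From mathcomp Require Import all_boot all_order all_algebra.
From mathcomp Require Import mpoly.
From mathcomp Require Import complex.
From mathcomp Require Import all_classical all_reals all_analysis.
From mathcomp Require Import ring lra.

Import Order.TTheory GRing.Theory Num.Theory.
Import numFieldNormedType.Exports.

Local Open Scope classical_set_scope.
Local Open Scope ring_scope.
Local Open Scope complex_scope.

(** Write the phase as [Phi = 2 pi tau F + sum_k t_k ln x_k] and differentiate
    along the fields [x_k d/dx_k], which kill the second derivatives of the
    [t]-part. By Euler's identity the Euler field gives
    [psi1 = 2 pi tau d F + sum_k t_k], and if [F_j(x0) <> 0] the field
    [x_j d/dx_j] gives [psi2 = 2 pi tau P + t_j] with [P = x_j F_j]. Since
    [F(x0) = 0] while the Euler derivative of [P] at [x0] is [d P(x0) <> 0],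
    the gradients of [F] and [P] at [x0] are linearly independent; hence
    [(F, P)] is bi-Lipschitz near [x0] in two of the coordinates [x_j, x_k].

    With [ep = tau^(-1/2)], [q_i = ep psi_i] and [sg = 1 / (1 + q1^2 + q2^2)],
    integration by parts along [ep sg (q1 E + q2 x_j d/dx_j)] turns an
    amplitude into amplitudes smaller by a factor [(sqrt sg + ep)^2], uniformly
    in [t]. Two steps give [O(sg^2 + 1/tau)], and the bi-Lipschitz property
    bounds the integral of [sg^2] by [O(1/tau)].

    Iterated integrals of uniformly continuous functions supported in the unit
    cube are limits of Riemann sums, in which the coordinates can be treated
    in any order. *)

(** * Riemann sums for iterated integrals *)

Section RiemannSums.
Context {R : realType}.

Definition upd {n} (x : 'rV[R]_n) (k : 'I_n) (y : R) : 'rV[R]_n :=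
  \row_l (if l == k then y else x ord0 l).

(** Sampling at the midpoints of the cells keeps every sample strictly inside []0, 1[], where the
    logarithms are regular. *)
Definition gpt (N a : nat) : R := (a%:R + 2^-1) / N.+1%:R.

Fixpoint rsum (N n : nat) : ('rV[R]_n -> R) -> R :=
  match n with
  | 0 => fun f => f 0
  | m.+1 => fun f => N.+1%:R^-1 *
      \sum_(a < N.+1) @rsum N m (fun v => f (row_mx ((gpt N a)%:M : 'rV_1) v))
  end.

Definition avg {n} (N : nat) (k : 'I_n) (f : 'rV[R]_n -> R) (x : 'rV[R]_n) :=
  N.+1%:R^-1 * \sum_(a < N.+1) f (upd x k (gpt N a)).

Definition ucube {n} (x : 'rV[R]_n) := forall j, 0 < x ord0 j < 1.

Definition near_by {n} (h : R) (x y : 'rV[R]_n) :=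
  forall j, `|x ord0 j - y ord0 j| <= h.

Lemma row_mx0 n (a : R) (v : 'rV[R]_n) :
  (row_mx (a%:M : 'rV_1) v : 'rV_n.+1) ord0 ord0 = a.
Proof.
have -> : ord0 = lshift n (ord0 : 'I_1) by apply: val_inj.
by rewrite (row_mxEl (a%:M : 'rV_1) v) mxE.
Qed.

Lemma row_mxS n (a : R) (v : 'rV[R]_n) (k : 'I_n) :
  (row_mx (a%:M : 'rV_1) v : 'rV_n.+1) ord0 (lift ord0 k) = v ord0 k.
Proof.
have -> : lift ord0 k = rshift 1 k by apply: val_inj.
by rewrite (row_mxEr (a%:M : 'rV_1) v).
Qed.

Lemma rowP_cons n (x y : 'rV[R]_n.+1) : x ord0 ord0 = y ord0 ord0 ->
  (forall k : 'I_n, x ord0 (lift ord0 k) = y ord0 (lift ord0 k)) -> x = y.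
Proof.
move=> h0 hS; apply/rowP => j.
by have [k ->|->] := unliftP ord0 j; [exact: hS|exact: h0].
Qed.

Lemma upd_row0 n (a y : R) (v : 'rV[R]_n) :
  upd (row_mx (a%:M : 'rV_1) v : 'rV_n.+1) ord0 y = row_mx (y%:M : 'rV_1) v.
Proof.
apply: rowP_cons => [|k]; rewrite mxE ?row_mx0 ?eqxx//.
by rewrite !row_mxS.
Qed.

Lemma upd_rowS n (a y : R) (v : 'rV[R]_n) (k : 'I_n) :
  upd (row_mx (a%:M : 'rV_1) v : 'rV_n.+1) (lift ord0 k) y =
  row_mx (a%:M : 'rV_1) (upd v k y).
Proof.
apply: rowP_cons => [|l]; rewrite mxE ?row_mx0//.
by rewrite !row_mxS mxE (inj_eq lift_inj).
Qed.

Lemma ler_norm_avg N (F : 'I_N.+1 -> R) (e : R) :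
  (forall a, `|F a| <= e) -> `|N.+1%:R^-1 * \sum_(a < N.+1) F a| <= e.
Proof.
move=> Fe; rewrite normrM ger0_norm ?invr_ge0//.
rewrite ler_pdivrMl ?ltr0Sn//.
apply: (le_trans (ler_norm_sum _ _ _)).
apply: (le_trans (ler_sum _ (fun i _ => Fe i))).
by rewrite sumr_const card_ord mulr_natl.
Qed.

Lemma gpt_itv N a : (a < N.+1)%N -> 0 < gpt N a < 1.
Proof.
move=> aN; rewrite /gpt divr_gt0 ?ltr0Sn ?addr_ge0 ?ltr_pwDr ?invr_gt0//=.
rewrite ltr_pdivrMr ?ltr0Sn// mul1r.
rewrite (@lt_le_trans _ _ (a.+1%:R))//; last by rewrite ler_nat.
by rewrite -[a.+1]addn1 natrD; lra.
Qed.

Lemma ucube_row n (a : R) (v : 'rV[R]_n) : 0 < a < 1 -> ucube v ->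
  ucube (row_mx (a%:M : 'rV_1) v : 'rV_n.+1).
Proof.
move=> a01 v01 j.
by have [k ->|->] := unliftP ord0 j; rewrite ?row_mx0 ?row_mxS.
Qed.

Lemma eq_rsum N n (f g : 'rV[R]_n -> R) : (forall x, ucube x -> f x = g x) ->
  rsum N n f = rsum N n g.
Proof.
elim: n f g => [|n IH] f g fg /=; first by apply: fg => -[].
congr (_ * _); apply: eq_bigr => a _; apply: IH => v v01.
by apply: fg; apply: ucube_row => //; exact: gpt_itv.
Qed.

Lemma rsumD N n (f g : 'rV[R]_n -> R) :
  rsum N n (fun x => f x + g x) = rsum N n f + rsum N n g.
Proof.
elim: n f g => [|n IH] f g //=.
rewrite -mulrDr -big_split/=; congr (_ * _).
by apply: eq_bigr => a _; rewrite -IH.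
Qed.

Lemma rsumZ N n (c : R) (f : 'rV[R]_n -> R) :
  rsum N n (fun x => c * f x) = c * rsum N n f.
Proof.
elim: n f => [|n IH] f //=; rewrite [RHS]mulrCA; congr (_ * _); rewrite mulr_sumr.
by apply: eq_bigr => a _; rewrite -IH.
Qed.

Lemma rsum0 N n : rsum N n (fun=> 0) = 0.
Proof.
elim: n => [|n IH] //=; rewrite big1 ?mulr0// => a _; exact: IH.
Qed.

Lemma rsum_sum N n I (s : seq I) (f : I -> 'rV[R]_n -> R) :
  rsum N n (fun x => \sum_(i <- s) f i x) = \sum_(i <- s) rsum N n (f i).
Proof.
elim: s => [|i s IH]; first by under eq_rsum do rewrite big_nil; rewrite big_nil rsum0.
by under eq_rsum do rewrite big_cons; rewrite big_cons rsumD IH.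
Qed.

Lemma ler_norm_rsum N n (f : 'rV[R]_n -> R) (e : R) :
  (forall x, ucube x -> `|f x| <= e) -> `|rsum N n f| <= e.
Proof.
elim: n f => [|n IH] f fe /=; first by apply: fe => -[].
apply: ler_norm_avg => a; apply: IH => v v01; apply: fe.
by apply: ucube_row => //; exact: gpt_itv.
Qed.

Lemma ler_rsum N n (f g : 'rV[R]_n -> R) :
  (forall x, ucube x -> f x <= g x) -> rsum N n f <= rsum N n g.
Proof.
elim: n f g => [|n IH] f g fg /=; first by apply: fg => -[].
apply: ler_wpM2l; first by rewrite invr_ge0.
apply: ler_sum => a _; apply: IH => v v01; apply: fg.
by apply: ucube_row => //; exact: gpt_itv.
Qed.

(** Averaging once more over a coordinate that is averaged anyway changes nothing. This takes the
    place of Fubini's theorem: any chosen coordinate can be treated as the innermost one. *)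
Lemma rsum_avg N n (k : 'I_n) (f : 'rV[R]_n -> R) :
  rsum N n f = rsum N n (avg N k f).
Proof.
elim: n k f => [[]//|n IH] k f /=; have [k' ->|->] := unliftP ord0 k; last first.
  (* Here [k] is the outermost coordinate; after averaging, the summand no longer depends on [a], so
     the outer mean has equal terms. *)
  set S := (X in _ = _ * X).
  have -> : S = \sum_(a < N.+1) N.+1%:R^-1 *
     \sum_(b < N.+1) rsum N n (fun v => f (row_mx ((gpt N b)%:M : 'rV_1) v)).
    apply: eq_bigr => a _; rewrite -rsum_sum -rsumZ; apply: eq_rsum => v _.
    by rewrite /avg; congr (_ * _); apply: eq_bigr => b _; rewrite upd_row0.
  by rewrite sumr_const card_ord -[in RHS]mulrnAl -[X in _ = _ * (X * _)]mulr_natl mulfV ?pnatr_eq0// mul1r.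
congr (_ * _); apply: eq_bigr => a _; rewrite (IH k'); apply: eq_rsum => v _.
by rewrite /avg; congr (_ * _); apply: eq_bigr => b _; rewrite upd_rowS.
Qed.

Lemma telescope_grid (g : R -> R) N :
  \sum_(a < N.+1) (g (a.+1%:R / N.+1%:R) - g (a%:R / N.+1%:R)) = g 1 - g 0.
Proof.
rewrite -(big_mkord xpredT (fun a => g (a.+1%:R / N.+1%:R) - g (a%:R / N.+1%:R))).
by rewrite telescope_sumr// divff ?mul0r// pnatr_eq0.
Qed.

Lemma gpt_near N a (c : R) : (a%:R / N.+1%:R <= c <= a.+1%:R / N.+1%:R) ->
  `|c - gpt N a| <= N.+1%:R^-1.
Proof.
have Np : 0 < N.+1%:R^-1 :> R by rewrite invr_gt0 ltr0Sn.
rewrite /gpt -natr1; set u := _^-1 in Np *; set b := a%:R.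
move=> /andP[h1 h2]; rewrite ler_norml; apply/andP; split; nra.
Qed.

(** After telescoping [G 1 - G 0] over the cells, the mean value theorem replaces each increment by
    a value of [g] in the cell of the sample point. *)
Lemma riemann_antiderivative N (G g : R -> R) (e : R) :
  (forall x : R, 0 <= x <= 1 -> {for x, continuous G}) ->
  (forall x : R, 0 < x < 1 -> is_derive x (1 : R) G (g x)) ->
  (forall x y : R, 0 < x < 1 -> 0 < y < 1 -> `|x - y| <= N.+1%:R^-1 -> `|g x - g y| <= e) ->
  `|(G 1 - G 0) - N.+1%:R^-1 * \sum_(a < N.+1) g (gpt N a)| <= e.
Proof.
move=> Gc Gd ge; rewrite -(telescope_grid G N).
have N0 : N.+1%:R != 0 :> R by rewrite pnatr_eq0.
have Np : 0 < N.+1%:R^-1 :> R by rewrite invr_gt0 ltr0Sn.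
rewrite -[X in X - _](mulKf N0) -mulrBr mulr_sumr -sumrB.
apply: ler_norm_avg => a.
have lo : 0 <= a%:R / N.+1%:R :> R by rewrite mulr_ge0.
have hi : a.+1%:R / N.+1%:R <= 1 :> R by rewrite ler_pdivrMr ?ltr0Sn// mul1r ler_nat.
have ab : a%:R / N.+1%:R < a.+1%:R / N.+1%:R :> R.
  by rewrite ltr_pM2r// ltr_nat.
have [||c] := @MVT R G g _ _ ab.
- move=> x; rewrite in_itv/= => /andP[x1 x2]; apply: Gd.
  by rewrite (le_lt_trans lo)//= (lt_le_trans x2).
- apply: continuous_in_subspaceT => x; rewrite inE/= in_itv/= => /andP[x1 x2].
  by apply: Gc; rewrite (le_trans lo)//= (le_trans x2).
rewrite in_itv/= => /andP[c1 c2] ->.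
have -> : N.+1%:R * (g c * (a.+1%:R / N.+1%:R - a%:R / N.+1%:R)) = g c.
  by rewrite -mulrBl -natrB// subSnn mul1r mulrCA mulfV ?mulr1.
apply: ge.
- by rewrite (le_lt_trans lo)//= (lt_le_trans c2).
- exact: gpt_itv.
- by apply: gpt_near; rewrite !ltW.
Qed.

Definition ucont {n} (f : 'rV[R]_n -> R) := forall e, 0 < e ->
  exists2 h, 0 < h & forall x y, near_by h x y -> `|f x - f y| <= e.

(** Uniform continuity in the sup norm survives freezing coordinates, and vanishing outside the open
    cube cuts []0, +oo[] down to the unit interval. This makes the class suitable for induction on
    the dimension. *)
Definition nice {n} (f : 'rV[R]_n -> R) :=
  ucont f /\ forall x, ~ ucube x -> f x = 0.

Local Notation mu := (@lebesgue_measure R).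

Lemma riemann1 (g : R -> R) N (e : R) : continuous g ->
  (forall x : R, ~~ (0 < x < 1) -> g x = 0) ->
  (forall x y : R, `|x - y| <= N.+1%:R^-1 -> `|g x - g y| <= e) ->
  `|\int[mu]_(x in `]0%R, +oo[) g x - N.+1%:R^-1 * \sum_(a < N.+1) g (gpt N a)| <= e.
Proof.
move=> gc g0 ge.
have gi a b : mu.-integrable `[a, b] (EFin \o g).
  apply: continuous_compact_integrable; first exact: segment_compact.
  exact: continuous_subspaceT.
(* The base point [-1] lies to the left of [0], so that the fundamental theorem gives two-sided
   derivatives on all of [[0, 1]]. *)
pose G (x : R) := \int[mu]_(t in `[(-1)%R, x]) g t.
have Gd (x : R) : -1 < x < 3 -> is_derive x (1 : R) G (g x).
  move=> /andP[x1 x3].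
  have [d1 d2] := continuous_FTC1_closed x3 (gi _ _) x1 (gc x).
  apply: DeriveDef => //; rewrite -d2 derive1E//.
have -> : \int[mu]_(x in `]0%R, +oo[) g x = G 1 - G 0.
  rewrite /G Rintegral_itvB ?bnd_simp ?lerN10//=.
  rewrite Rintegral_mkcond [RHS]Rintegral_mkcond; congr Rintegral.
  apply/funext => x; rewrite /patch !mem_setE !in_itv/= andbT.
  have := g0 x; case: (ltP 0 x) => //= x0; case: (leP x 1) => //= x1; last by apply; rewrite -leNgt ltW.
apply: (@riemann_antiderivative N G g e) => [x x01|x x01|x y _ _]; last exact: ge.
  apply: differentiable_continuous; apply/derivable1_diffP.
  by have /Gd[] : -1 < x < 3 by lra.
by apply: Gd; lra.
Qed.

Lemma near_by_row n (h : R) (a b : R) (v w : 'rV[R]_n) :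
  `|a - b| <= h -> near_by h v w ->
  near_by h (row_mx (a%:M : 'rV_1) v : 'rV_n.+1) (row_mx (b%:M : 'rV_1) w).
Proof.
move=> ab vw j.
by have [k ->|->] := unliftP ord0 j; rewrite ?row_mx0 ?row_mxS.
Qed.

Lemma near_by_refl n (h : R) (v : 'rV[R]_n) : 0 <= h -> near_by h v v.
Proof. by move=> h0 j; rewrite subrr normr0. Qed.

Lemma nice_row n (f : 'rV[R]_n.+1 -> R) (a : R) : nice f ->
  nice (fun v : 'rV[R]_n => f (row_mx (a%:M : 'rV_1) v)).
Proof.
move=> [fu f0]; split=> [e e0|v v01].
  have [h h0 hf] := fu e e0; exists h => // v w vw.
  by apply: hf; apply: near_by_row => //; rewrite subrr normr0 ltW.
apply: f0 => H; apply: v01 => j.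
by have := H (lift ord0 j); rewrite row_mxS.
Qed.

Lemma exists_invS_le (h : R) : 0 < h -> exists N : nat, N.+1%:R^-1 <= h.
Proof.
move=> h0; have [N _ /(_ N (leqnn _))] := near_infty_natSinv_lt (PosNum h0).
by move=> /= /ltW; exists N.
Qed.

(** Induction on the dimension, each integration costing one error [e]. The inner integral [G] has
    to be continuous in the outer variable before the one-dimensional estimate applies. *)
Lemma iter_integral_rsum n (f : 'rV[R]_n -> R) (e h : R) N : nice f ->
  (forall x y, near_by h x y -> `|f x - f y| <= e) -> N.+1%:R^-1 <= h ->
  `|iter_integral f - rsum N n f| <= n%:R * e.
Proof.
elim: n f e h N => [|n IH] f e h N nf fe Nh; first by rewrite /= subrr normr0 mul0r.
pose fr a := fun v : 'rV[R]_n => f (row_mx (a%:M : 'rV_1) v).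
have nfr a : nice (fr a) by exact: nice_row.
pose G a := iter_integral (fr a).
(* [G] inherits the modulus of continuity of [f] without loss: the Riemann sums of two slices differ
   by at most [e1], and by the induction hypothesis they approximate [G a] and [G b] to any
   accuracy. *)
have osc e1 h1 a b : 0 <= h1 -> (forall x y, near_by h1 x y -> `|f x - f y| <= e1) ->
    `|a - b| <= h1 -> `|G a - G b| <= e1.
  move=> h10 H ab; apply/ler_addgt0Pr => e' e'0.
  have e2 : 0 < e' / (n%:R *+ 2 + 1) by rewrite divr_gt0// ltr_wpDl// mulrn_wge0.
  have [[ha ha0 Ha] [hb hb0 Hb]] := ((nfr a).1 _ e2, (nfr b).1 _ e2).
  have [|M HM] := @exists_invS_le (Num.min ha hb); first by rewrite lt_min ha0.
  have [HMa HMb] : M.+1%:R^-1 <= ha /\ M.+1%:R^-1 <= hb by apply/andP; rewrite -le_min.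
  have := IH _ _ _ M (nfr a) Ha HMa.
  have := IH _ _ _ M (nfr b) Hb HMb.
  have : `|rsum M n (fr a) - rsum M n (fr b)| <= e1.
    rewrite -[rsum M n (fr b)]mul1r -mulNr -rsumZ -rsumD.
    apply: ler_norm_rsum => v _; rewrite mulN1r; apply: H.
    by apply: near_by_row => //; exact: near_by_refl.
  have : n%:R * (e' / (n%:R *+ 2 + 1)) *+ 2 <= e'.
    rewrite mulrA -mulrnAl ler_pdivrMr ?ltr_wpDl// ?mulrn_wge0//.
    by rewrite -mulrnAl mulrC ler_pM2l// lerDl.
  rewrite -/(G a) -/(G b) => ? ? ? ?.
  have -> : G a - G b = (G a - rsum M n (fr a)) + (rsum M n (fr a) - rsum M n (fr b)) - (G b - rsum M n (fr b)) by ring.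
  rewrite (le_trans (ler_normB _ _))// (le_trans (lerD (ler_normD _ _) (lexx _)))//.
  lra.
have h0 : 0 <= h by rewrite (le_trans _ Nh).
have Gc : continuous G.
  move=> a; apply/cvgrPdist_le => e1 e10.
  have [h1 h10 H1] := nf.1 _ e10.
  apply/nbhs_ballP; exists h1 => // b /ltW ab.
  by apply: (osc e1 h1) => //; exact: ltW.
have G0 a : ~~ (0 < a < 1) -> G a = 0.
  move=> a01; have fr0 : fr a = fun=> 0.
    apply/funext => v; apply: nf.2 => H; move: a01.
    by have := H ord0; rewrite row_mx0 => ->.
  have : `|G a - rsum 0 n (fr a)| <= n%:R * 0.
    by apply: (IH _ _ 1) => // [x y _|]; rewrite ?invr1// fr0 subrr normr0.
  by rewrite fr0 rsum0 mulr0 subr0 normr_le0 => /eqP.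
have Hint : `|iter_integral f - N.+1%:R^-1 * \sum_(a < N.+1) G (gpt N a)| <= e.
  apply: (@riemann1 G) => // x y xy; apply: (osc e h) => //.
  exact: le_trans xy Nh.
have -> : n.+1%:R * e = n%:R * e + e by rewrite -natr1 mulrDl mul1r.
move: Hint; set S := _^-1 * _ => Hint; set T := rsum _ _ _.
rewrite (le_trans (ler_distD S _ _))// addrC lerD//.
rewrite /S /T -mulrBr -sumrB; apply: ler_norm_avg => a.
apply: (IH (fr (gpt N a)) e h) => // x y xy; apply: fe.
by apply: near_by_row => //; rewrite subrr normr0.
Qed.

End RiemannSums.

(** * Linearity and integration by parts for iterated integrals *)

Section NiceFunctions.
Context {R : realType} {n : nat}.
Implicit Types (f g : 'rV[R]_n -> R) (x : 'rV[R]_n) (k : 'I_n).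

Lemma updE x k (y : R) : (upd x k y) ord0 k = y.
Proof. by rewrite mxE eqxx. Qed.

Lemma upd_upd x k (y z : R) : upd (upd x k y) k z = upd x k z.
Proof. by apply/rowP => l; rewrite !mxE; case: eqP. Qed.

Lemma upd_id x k : upd x k (x ord0 k) = x.
Proof. by apply/rowP => l; rewrite !mxE; case: eqP => // ->. Qed.

Lemma ucube_upd x k (y : R) : ucube x -> 0 < y < 1 -> ucube (upd x k y).
Proof. by move=> x01 y01 l; rewrite mxE; case: eqP. Qed.

Lemma near_by_upd x k (y z h : R) : `|y - z| <= h ->
  near_by h (upd x k y) (upd x k z).
Proof.
move=> yz l; rewrite !mxE; case: eqP => // _.
by rewrite subrr normr0 (le_trans _ yz).
Qed.

Lemma niceD f g : nice f -> nice g -> nice (fun x => f x + g x).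
Proof.
move=> [fu f0] [gu g0]; split=> [e e0|x x01]; last by rewrite f0// g0// addr0.
have e2 : 0 < e / 2 by rewrite divr_gt0.
have [[h1 h10 H1] [h2 h20 H2]] := (fu _ e2, gu _ e2).
exists (Num.min h1 h2); first by rewrite lt_min h10.
move=> x y xy.
have : `|f x - f y| <= e / 2.
  by apply: H1 => j; rewrite (le_trans (xy j))// ge_min lexx.
have : `|g x - g y| <= e / 2.
  by apply: H2 => j; rewrite (le_trans (xy j))// ge_min lexx orbT.
rewrite opprD addrACA => ? ?; rewrite (le_trans (ler_normD _ _))//; lra.
Qed.

Lemma niceZ (c : R) f : nice f -> nice (fun x => c * f x).
Proof.
move=> [fu f0]; split=> [e e0|x x01]; last by rewrite f0// mulr0.
have c1 : 0 < `|c| + 1 by rewrite ltr_wpDl.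
have [h h0 H] := fu _ (divr_gt0 e0 c1).
exists h => // x y /H xy; rewrite -mulrBr normrM.
rewrite (le_trans (ler_wpM2l _ xy))// mulrCA ger_pMr//.
by rewrite ler_pdivrMr// mul1r lerDl.
Qed.

Lemma nice0 : nice (fun _ : 'rV[R]_n => 0 : R).
Proof.
by split=> // e e0; exists 1 => // x y _; rewrite subrr normr0 ltW.
Qed.

Lemma nice_sum I (s : seq I) (f : I -> 'rV[R]_n -> R) :
  (forall i, nice (f i)) -> nice (fun x => \sum_(i <- s) f i x).
Proof.
move=> nf; elim: s => [|i s IH].
  by rewrite (_ : (fun x => _) = fun=> 0); [exact: nice0|apply/funext => x; rewrite big_nil].
rewrite (_ : (fun x => _) = fun x => f i x + \sum_(i <- s) f i x); first exact: niceD.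
by apply/funext => x; rewrite big_cons.
Qed.

Lemma invS_le (N M : nat) (h : R) : N.+1%:R^-1 <= h -> (N <= M)%N -> M.+1%:R^-1 <= h.
Proof.
move=> Nh NM; apply: le_trans Nh.
by rewrite lef_pV2 ?posrE ?ltr0Sn// ler_nat.
Qed.

Lemma rsum_approx f : nice f -> forall e, 0 < e -> exists M : nat,
  forall N, (M <= N)%N -> `|iter_integral f - rsum N n f| <= e.
Proof.
move=> nf e e0; have n1 : 0 < n.+1%:R :> R by rewrite ltr0Sn.
have [h h0 H] := nf.1 _ (divr_gt0 e0 n1).
have [M HM] := exists_invS_le _ h0.
exists M => N MN; apply: (le_trans (iter_integral_rsum _ _ _ _ _ nf H (invS_le _ _ _ HM MN))).
by rewrite mulrCA ger_pMr// ler_pdivrMr// mul1r ler_nat.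
Qed.

(** Bounds along arbitrarily fine grids are enough; the later estimates hold only once the mesh is
    small compared with [tau^(-1/2)]. *)
Lemma ler_norm_iter_integral f (e : R) : nice f ->
  (forall M : nat, exists2 N, (M <= N)%N & `|rsum N n f| <= e) ->
  `|iter_integral f| <= e.
Proof.
move=> nf H; apply/ler_addgt0Pr => e' e'0.
have [M HM] := rsum_approx _ nf _ e'0.
have [N /HM h1 h2] := H M.
by rewrite -(subrK (rsum N n f) (iter_integral f)) (le_trans (ler_normD _ _))// addrC lerD.
Qed.

Lemma iter_integralD f g : nice f -> nice g ->
  iter_integral (fun x => f x + g x) = iter_integral f + iter_integral g.
Proof.
move=> nf ng; apply/eqP; rewrite -subr_eq0 -normr_le0; apply/ler_addgt0Pr => e e0.
have e3 : 0 < e / 3 by rewrite divr_gt0.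
have [[M1 H1] [M2 H2] [M3 H3]] := And3 (rsum_approx _ nf _ e3) (rsum_approx _ ng _ e3)
  (rsum_approx _ (niceD _ _ nf ng) _ e3).
pose N := maxn M1 (maxn M2 M3).
have := H1 N (leq_maxl _ _); have := H2 N (leq_trans (leq_maxl _ _) (leq_maxr _ _)).
have := H3 N (leq_trans (leq_maxr _ _) (leq_maxr _ _)).
rewrite rsumD add0r !ler_norml => /andP[? ?] /andP[? ?] /andP[? ?].
by apply/andP; split; lra.
Qed.

Lemma iter_integralZ (c : R) f : nice f ->
  iter_integral (fun x => c * f x) = c * iter_integral f.
Proof.
move=> nf; apply/eqP; rewrite -subr_eq0 -normr_le0; apply/ler_addgt0Pr => e e0.
have e2 : 0 < e / (`|c| + 2) by rewrite divr_gt0// ltr_wpDl.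
have [[M1 H1] [M2 H2]] := (rsum_approx _ nf _ e2, rsum_approx _ (niceZ c _ nf) _ e2).
have {H1} := H1 _ (leq_maxl M1 M2); have {H2} := H2 _ (leq_maxr M1 M2).
rewrite rsumZ add0r; set N := maxn _ _; set I1 := iter_integral _; set I2 := iter_integral _.
set s := rsum _ _ _ => h1 h2.
have -> : I1 - c * I2 = (I1 - c * s) - c * (I2 - s) by ring.
rewrite (le_trans (ler_normB _ _))// normrM.
rewrite (le_trans (lerD h1 (ler_wpM2l _ h2)))//.
rewrite -[X in X + _]mul1r -mulrDl mulrCA ger_pMr// ler_pdivrMr ?mul1r ?ltr_wpDl//.
by rewrite addrC lerD2l; lra.
Qed.

Lemma iter_integral_sum I (s : seq I) (f : I -> 'rV[R]_n -> R) :
  (forall i, nice (f i)) ->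
  iter_integral (fun x => \sum_(i <- s) f i x) = \sum_(i <- s) iter_integral (f i).
Proof.
move=> nf; elim: s => [|i s IH].
  rewrite big_nil (_ : (fun x => _) = fun x => 0 * 0).
    by rewrite iter_integralZ ?mul0r//; exact: nice0.
  by apply/funext => x; rewrite big_nil mul0r.
rewrite big_cons -IH -iter_integralD//; last exact: nice_sum.
by congr iter_integral; apply/funext => x; rewrite big_cons.
Qed.

(** Integration by parts without boundary terms. The grid mean of [f'] along coordinate [k] is close
    to the difference of [f] at the two ends of the segment, where [f] vanishes; averaging in that
    coordinate first avoids any exchange of integrals. *)
Lemma iter_integral_partial k f f' : nice f -> nice f' ->
  (forall x, ucube x ->
    is_derive (x ord0 k) (1 : R) (fun y : R => f (upd x k y)) (f' x)) ->
  iter_integral f' = 0.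
Proof.
move=> nf nf' fd; apply/eqP; rewrite -normr_le0; apply/ler_addgt0Pr => e e0.
have n1 : 0 < n.+1%:R :> R by rewrite ltr0Sn.
have [h h0 H] := nf'.1 _ (divr_gt0 e0 n1).
have [N HN] := exists_invS_le _ h0.
have h1 := iter_integral_rsum _ _ _ _ _ nf' H HN.
have h2 : `|rsum N n f'| <= e / n.+1%:R.
  rewrite (rsum_avg _ _ k); apply: ler_norm_rsum => x x01.
  pose G (y : R) := f (upd x k y); pose g (y : R) := f' (upd x k y).
  have G01 (y : R) : ~~ (0 < y < 1) -> G y = 0.
    by move=> y01; apply: nf.2 => /(_ k); rewrite updE; exact/negP.
  have : `|(G 1 - G 0) - N.+1%:R^-1 * \sum_(a < N.+1) g (gpt N a)| <= e / n.+1%:R.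
    apply: riemann_antiderivative => [y _|y y01|y z _ _ yz].
    - apply/cvgrPdist_le => d d0; have [r r0 Hr] := nf.1 _ d0.
      apply/nbhs_ballP; exists r => // z /ltW yz.
      by apply: Hr; exact: near_by_upd.
    - have := fd (upd x k y) (ucube_upd _ _ _ x01 y01); rewrite updE /G.
      by under eq_fun do rewrite upd_upd.
    - by apply: H; apply: near_by_upd; exact: le_trans yz HN.
  by rewrite !G01 ?ltxx ?andbF// subrr sub0r normrN.
rewrite add0r -(subrK (rsum N n f') (iter_integral f')).
rewrite (le_trans (ler_normD _ _))// (le_trans (lerD h1 h2))//.
by rewrite -[X in _ + X]mul1r -mulrDl natr1 mulrC divfK// gt_eqF.
Qed.

Lemma ball_rowP x (e : R) (y : 'rV[R]_n) : 0 < e ->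
  (forall j, `|x ord0 j - y ord0 j| < e) -> ball x e y.
Proof. by move=> e0 H; split=> // i j; rewrite (ord1 i); exact: H. Qed.

(** Heine's theorem through the near-covering form of compactness. If only one of two nearby points
    lies in [K], the bound centred at that point applies by symmetry. *)
Lemma ucont_compact f (K : set 'rV[R]_n) : compact K -> continuous f ->
  (forall x, ~ K x -> f x = 0) -> ucont f.
Proof.
move=> cK cf f0 e e0; have e2 : 0 < e / 2 by rewrite divr_gt0.
pose P (h : R) (x : 'rV[R]_n) := forall y, near_by h x y -> `|f x - f y| <= e.
(* Halving the radius leaves room for a displacement [h < r / 2] from a point that is itself within
   [r / 2] of [x]. *)
have cov x : K x -> \forall x' \near x & h \near (0 : R)^'+, P h x'.
  move=> _; have /cvgrPdist_le /(_ _ e2) /nbhs_ballP[r r0 Hr] := cf x.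
  have r2 : 0 < r / 2 by rewrite divr_gt0.
  exists (ball x (r / 2), [set h : R | h < r / 2]) => /=.
    by split; [exact: nbhsx_ballx|exact: nbhs_right_lt].
  move=> -[x' h] /= [xx' hr] y x'y.
  have rr : ball x r y.
    apply: ball_rowP => // j; rewrite (le_lt_trans (ler_distD (x' ord0 j) _ _))//.
    rewrite (splitr r) ltrD//; last exact: le_lt_trans (x'y j) hr.
    by case: xx' => _ /(_ ord0 j).
  have rx : ball x r x'.
    apply: ball_rowP => // j; case: xx' => _ /(_ ord0 j) /= /lt_le_trans; apply.
    by rewrite ler_pdivrMr// ler_peMr ?ler1n// ltW.
  have := Hr _ rr; have := Hr _ rx => /= h1 h2.
  rewrite (le_trans (ler_distD (f x) _ _))// (splitr e) lerD//.
  by rewrite distrC.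
have := compact_near_coveringP K => -[/(_ cK) + _].
move=> /(_ R (0 : R)^'+ P _ cov) H.
have [h [HP h0]] : exists h : R, (forall x, K x -> P h x) /\ 0 < h.
  suff : \forall h \near (0 : R)^'+, K `<=` P h /\ 0 < h by move=> /(@filter_ex _ _ (at_right_proper_filter _))[h []]; exists h.
  by apply: filterI; [exact: H|exact: nbhs_right_gt].
exists h => // x y xy.
have [Kx|nKx] := pselect (K x); first exact: HP.
have [Ky|nKy] := pselect (K y); last by rewrite !f0// subrr normr0 ltW.
by rewrite distrC; apply: HP => // j; rewrite distrC.
Qed.

End NiceFunctions.

(** * Calculus of polynomial functions *)

Section RealDerivatives.
Context {R : realType}.
Implicit Types (f g : R -> R) (y a b : R).

Lemma der_add f g y a b : is_derive y (1 : R) f a -> is_derive y (1 : R) g b ->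
  is_derive y (1 : R) (fun z => f z + g z) (a + b).
Proof. exact: is_deriveD. Qed.

Lemma der_mul f g y a b : is_derive y (1 : R) f a -> is_derive y (1 : R) g b ->
  is_derive y (1 : R) (fun z => f z * g z) (a * g y + f y * b).
Proof.
move=> fa gb; apply: (@is_derive_eq _ _ _ (f * g) _ _ _ _ (is_deriveM fa gb)).
by rewrite addrC mulrC.
Qed.

Lemma der_cst y a : is_derive y (1 : R) (fun=> a) 0.
Proof. exact: is_derive_cst. Qed.

Lemma der_id y : is_derive y (1 : R) (fun z => z) 1.
Proof. exact: is_derive_id. Qed.

Lemma der_comp f g y a b : is_derive y (1 : R) f a ->
  is_derive (f y) (1 : R) g b -> is_derive y (1 : R) (fun z => g (f z)) (b * a).
Proof. by move=> fa gb; apply: is_derive1_comp. Qed.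

Lemma der_sum I (s : seq I) (F : I -> R -> R) (F' : I -> R) y :
  (forall i, is_derive y (1 : R) (F i) (F' i)) ->
  is_derive y (1 : R) (fun z => \sum_(i <- s) F i z) (\sum_(i <- s) F' i).
Proof.
move=> FF'; elim: s => [|i s IH].
  by under eq_fun do rewrite big_nil; rewrite big_nil; exact: der_cst.
by under eq_fun do rewrite big_cons; rewrite big_cons; exact: der_add.
Qed.

Lemma der_inv f y a : f y != 0 -> is_derive y (1 : R) f a ->
  is_derive y (1 : R) (fun z => (f z)^-1) (- (f y)^-1 ^+ 2 * a).
Proof.
move=> fy0 [fd fa]; apply: DeriveDef; first exact: derivableV.
by rewrite deriveV// fa -[_ *: _]/(_ * _) exprVn.
Qed.

End RealDerivatives.

Section PolynomialFunctions.
Context {R : realType} {n : nat}.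
Implicit Types (p q : {mpoly R[n]}) (x : 'rV[R]_n) (j k : 'I_n).

Lemma mpoly_ring_ind (P : {mpoly R[n]} -> Prop) :
  (forall c, P c%:MP) -> (forall i, P 'X_i) ->
  (forall p q, P p -> P q -> P (p + q)) ->
  (forall p q, P p -> P q -> P (p * q)) -> forall p, P p.
Proof.
move=> PC PX PD PM p; rewrite (mpolyE p).
apply: big_ind; [by rewrite -(mpolyC0 n R)|exact: PD|].
move=> m _; rewrite -mul_mpolyC; apply: (PM _ _ (PC _)); rewrite mpolyXE_id.
apply: big_ind; [by rewrite -(mpolyC1 n R)|exact: PM|].
move=> i _; elim: (m i) => [|e IH]; first by rewrite expr0 -(mpolyC1 n R); exact: PC.
by rewrite exprS; exact: PM.
Qed.

Lemma continuous_meval p : continuous (fun x : 'rV[R]_n => p.@[x ord0]).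
Proof.
elim/mpoly_ring_ind: p => [c|i|p q cp cq|p q cp cq].
- by under eq_fun do rewrite mevalC; exact: cst_continuous.
- by under eq_fun do rewrite mevalXU; exact: coord_continuous.
- under eq_fun do rewrite mevalD.
  by move=> x; exact: (cvgD (cp x) (cq x)).
- under eq_fun do rewrite mevalM.
  by move=> x; exact: (cvgM (cp x) (cq x)).
Qed.

Lemma is_derive_meval p k x :
  is_derive (x ord0 k) (1 : R) (fun y : R => p.@[(upd x k y) ord0]) p^`M(k).@[x ord0].
Proof.
elim/mpoly_ring_ind: p => [c|i|p q cp cq|p q cp cq].
- under eq_fun do rewrite mevalC.
  by rewrite mderivC meval0; exact: der_cst.
- rewrite mderivX mevalZ mnm1E.
  under eq_fun do rewrite mevalXU mxE.
  case: (i =P k) => [->|/eqP ik]; last by rewrite mul0r; exact: der_cst.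
  rewrite mul1r (_ : (U_(k) - U_(k))%MM = 0%MM) ?mpolyX0 ?meval1; first exact: der_id.
  by apply/mnmP => l; rewrite mnmBE mnm0E subnn.
- under eq_fun do rewrite mevalD.
  by rewrite mderivD mevalD; exact: der_add.
- under eq_fun do rewrite mevalM.
  rewrite mderivM mevalD !mevalM.
  by have := der_mul _ _ _ _ _ cp cq; rewrite /= !upd_id.
Qed.

Lemma meval_bounded p : exists2 C : R, 0 <= C &
  forall x, ucube x -> `|p.@[x ord0]| <= C.
Proof.
elim/mpoly_ring_ind: p => [c|i|p q [C C0 HC] [D D0 HD]|p q [C C0 HC] [D D0 HD]].
- by exists `|c| => // x _; rewrite mevalC.
- exists 1 => // x x01; rewrite mevalXU; have /andP[x0 x1] := x01 i.
  by rewrite ger0_norm ltW.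
- exists (C + D); first exact: addr_ge0.
  move=> x x01; rewrite mevalD (le_trans (ler_normD _ _))//.
  by rewrite lerD ?HC ?HD.
- exists (C * D); first exact: mulr_ge0.
  by move=> x x01; rewrite mevalM normrM ler_pM ?HC ?HD.
Qed.

Lemma meval_near p (x0 : 'rV[R]_n) (e : R) : 0 < e -> exists2 h : R, 0 < h &
  forall x, near_by h x x0 -> `|p.@[x ord0] - p.@[x0 ord0]| <= e.
Proof.
move=> e0; have /cvgrPdist_le /(_ _ e0) /nbhs_ballP[r r0 Hr] := continuous_meval p x0.
exists (r / 2); first by rewrite divr_gt0.
move=> x xx0; rewrite distrC; apply: Hr; apply: ball_rowP => // l.
rewrite distrC (le_lt_trans (xx0 l))// ltr_pdivrMr// ltr_pMr// ltr1n//.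
Qed.

Definition logderiv k p : {mpoly R[n]} := 'X_k * p^`M(k).

Lemma logderivX k (m : 'X_{1..n}) :
  logderiv k ('X_[m] : {mpoly R[n]}) = (m k)%:R *: 'X_[m].
Proof.
(* Exponents are subtracted with truncation, so [m k = 0] is separate; there the coefficient
   vanishes. *)
rewrite /logderiv mderivX -scalerAr; have [->|mk] := posnP (m k); first by rewrite !scale0r.
congr (_ *: _); rewrite -mpolyXD; congr mpolyX.
apply/mnmP => l; rewrite mnmDE mnmBE mnm1E.
by case: eqP => [<-|_]; rewrite ?subnKC// add0n subn0.
Qed.

Lemma logderivE k p :
  logderiv k p = \sum_(m <- msupp p) ((m k)%:R * p@_m) *: 'X_[m].
Proof.
rewrite {1}(mpolyE p) /logderiv raddf_sum mulr_sumr /=.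
apply: eq_bigr => m _.
by rewrite mderivZ -scalerAr -/(logderiv k _) logderivX scalerA mulrC.
Qed.

(** Each monomial is an eigenvector of every [logderiv k], and its eigenvalues add up to its degree.
    The coefficients [c] are left free so that the identity covers both [p] and [logderiv j p],
    which is expanded over the same monomials. *)
Lemma euler_sum (d : nat) p (c : 'X_{1..n} -> R) : p \is d.-homog ->
  \sum_k logderiv k (\sum_(m <- msupp p) c m *: 'X_[m]) =
  d%:R *: \sum_(m <- msupp p) c m *: 'X_[m].
Proof.
move=> /dhomogP hp; rewrite scaler_sumr.
rewrite (eq_bigr (fun k => \sum_(m <- msupp p) (c m * (m k)%:R) *: 'X_[m])); last first.
  move=> k _; rewrite /logderiv raddf_sum mulr_sumr /=; apply: eq_bigr => m _.
  by rewrite mderivZ -scalerAr -/(logderiv k _) logderivX scalerA.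
rewrite exchange_big/= big_seq [RHS]big_seq; apply: eq_bigr => m mp.
rewrite -scaler_suml -mulr_sumr scalerA; congr (_ *: _).
by rewrite mulrC -natr_sum -mdegE (hp m mp).
Qed.

Lemma euler (d : nat) p : p \is d.-homog -> \sum_k logderiv k p = d%:R *: p.
Proof. by move=> hp; have := euler_sum d p (fun m => p@_m) hp; rewrite -mpolyE. Qed.

Lemma euler_logderiv (d : nat) p j : p \is d.-homog ->
  \sum_k logderiv k (logderiv j p) = d%:R *: logderiv j p.
Proof. by move=> hp; rewrite (logderivE j p); exact: euler_sum. Qed.

(* Contracting the minors with [x] gives [d x_j F_j(x)^2] by Euler's identity. *)
Lemma exists_minor (d : nat) p j x : (0 < d)%N -> p \is d.-homog ->
  0 < x ord0 j -> p.@[x ord0] = 0 -> p^`M(j).@[x ord0] != 0 ->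
  exists2 k, k != j & p^`M(j).@[x ord0] * (logderiv j p)^`M(k).@[x ord0] -
             p^`M(k).@[x ord0] * (logderiv j p)^`M(j).@[x ord0] != 0.
Proof.
move=> d0 hp xj px pj.
set D := fun k => p^`M(j).@[x ord0] * (logderiv j p)^`M(k).@[x ord0] -
  p^`M(k).@[x ord0] * (logderiv j p)^`M(j).@[x ord0].
suff : exists k, D k != 0.
  move=> [k Dk]; exists k => //; apply: contra_neq Dk => ->.
  by rewrite /D subrr.
apply/existsP; rewrite -[X in is_true X]negbK negb_exists; apply/negP => /forallP D0.
have : \sum_k x ord0 k * D k = 0.
  by apply: big1 => k _; have := D0 k; rewrite negbK => /eqP ->; rewrite mulr0.
have E q c : \sum_k logderiv k q = c *: q ->
    \sum_k x ord0 k * q^`M(k).@[x ord0] = c * q.@[x ord0].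
  move=> /(congr1 (meval (x ord0))); rewrite mevalZ raddf_sum => <-.
  by apply: eq_bigr => k _; rewrite /logderiv /= mevalM mevalXU.
have -> : \sum_k x ord0 k * D k =
    p^`M(j).@[x ord0] * (\sum_k x ord0 k * (logderiv j p)^`M(k).@[x ord0]) -
    (logderiv j p)^`M(j).@[x ord0] * (\sum_k x ord0 k * p^`M(k).@[x ord0]).
  by rewrite !mulr_sumr -sumrB; apply: eq_bigr => k _; rewrite /D; ring.
rewrite (E _ _ (euler _ _ hp)) (E _ _ (euler_logderiv _ _ j hp)).
rewrite px !mulr0 subr0 mevalM mevalXU => /eqP; rewrite !mulf_eq0 (negbTE pj) (gt_eqF xj).
by rewrite pnatr_eq0 gtn_eqF.
Qed.

Lemma meval_mvt p k x (x0 : 'rV[R]_n) (b b' h : R) :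
  near_by h (upd x k b) x0 -> near_by h (upd x k b') x0 ->
  exists2 z, near_by h z x0 &
    p.@[(upd x k b) ord0] - p.@[(upd x k b') ord0] = p^`M(k).@[z ord0] * (b - b').
Proof.
wlog bb : b b' / b' <= b => [H hb hb'|hb hb'].
  have [|/ltW] := leP b' b => bb; first exact: H.
  have [z hz E] := H _ _ bb hb' hb; exists z => //.
  by rewrite -opprB E -mulrN opprB.
have [||c] := @MVT_segment R (fun y => p.@[(upd x k y) ord0])
   (fun y => p^`M(k).@[(upd x k y) ord0]) _ _ bb.
- move=> y _; have := is_derive_meval p k (upd x k y); rewrite updE.
  by under eq_fun do rewrite upd_upd.
- apply: continuous_subspaceT => y.
  apply: differentiable_continuous; apply/derivable1_diffP.
  have := is_derive_meval p k (upd x k y); rewrite updE.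
  by under eq_fun do rewrite upd_upd; case.
rewrite in_itv/= => /andP[c1 c2] ->; exists (upd x k c) => // l.
have := hb l; have := hb' l; rewrite !mxE; case: eqP => // _.
rewrite !ler_norml => /andP[? ?] /andP[? ?]; apply/andP; split; lra.
Qed.

Lemma updC x j k (a b : R) : k != j -> upd (upd x j a) k b = upd (upd x k b) j a.
Proof.
move=> kj; apply/rowP => l; rewrite !mxE.
by case: (l =P k) => // ->; rewrite (negbTE kj).
Qed.

(** Cramer's rule bounds [D * |a|] and [D * |b|] through the unperturbed linear forms. Passing to
    the perturbed forms costs [4 * B * e * S = D / 2 * S] with [S = |a| + |b|], which is absorbed on
    the left. *)
Lemma linear_lower_bound (al be ga de a1 b1 g1 d1 a b e B D : R) :
  0 < B -> `|al| <= B -> `|be| <= B -> `|ga| <= B -> `|de| <= B ->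
  `|a1 - al| <= e -> `|b1 - be| <= e -> `|g1 - ga| <= e -> `|d1 - de| <= e ->
  D = `|al * de - be * ga| -> 8 * B * e = D ->
  D / (4 * B) * (`|a| + `|b|) <= `|a1 * a + b1 * b| + `|g1 * a + d1 * b|.
Proof.
move=> B0 hal hbe hga hde h1 h2 h3 h4 DE De.
set P := a1 * a + b1 * b; set Q := g1 * a + d1 * b.
set S := `|a| + `|b|.
have S0 : 0 <= S by rewrite addr_ge0.
have key (u v u1 v1 : R) : `|u1 - u| <= e -> `|v1 - v| <= e ->
    `|u * a + v * b| <= `|u1 * a + v1 * b| + e * S.
  move=> hu hv.
  have -> : u * a + v * b = (u1 * a + v1 * b) - ((u1 - u) * a + (v1 - v) * b) by ring.
  rewrite (le_trans (ler_normB _ _))// lerD2l (le_trans (ler_normD _ _))//.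
  by rewrite !normrM /S mulrDr lerD// ler_wpM2r.
have KP := key _ _ _ _ h1 h2; have KQ := key _ _ _ _ h3 h4.
rewrite -/P -/Q in KP KQ.
have Da : D * `|a| <= B * (`|P| + e * S) + B * (`|Q| + e * S).
  rewrite DE -normrM.
  have -> : (al * de - be * ga) * a = de * (al * a + be * b) - be * (ga * a + de * b) by ring.
  by rewrite (le_trans (ler_normB _ _))// !normrM lerD// ler_pM.
have Db : D * `|b| <= B * (`|P| + e * S) + B * (`|Q| + e * S).
  rewrite DE -normrM.
  have -> : (al * de - be * ga) * b = al * (ga * a + de * b) - ga * (al * a + be * b) by ring.
  by rewrite (le_trans (ler_normB _ _))// !normrM addrC lerD// ler_pM.
rewrite mulrAC ler_pdivrMr; last by rewrite mulr_gt0.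
have : D * S <= 2 * (B * (`|P| + e * S) + B * (`|Q| + e * S)) by rewrite [leLHS]mulrDr; lra.
have -> : D * S = 8 * B * e * S by rewrite De.
have -> : (`|P| + `|Q|) * (4 * B) = 4 * (B * `|P|) + 4 * (B * `|Q|) by ring.
rewrite !mulrDr; lra.
Qed.

(** Through the corner with coordinates [a] and [b'], the mean value theorem makes both increments
    linear in [a - a'] and [b - b'], with coefficients close to the partial derivatives at [x0]. The
    Jacobian there is nonzero, so the linear estimate applies. *)
Lemma bilipschitz p q j k (x0 : 'rV[R]_n) : k != j ->
  p^`M(j).@[x0 ord0] * q^`M(k).@[x0 ord0] -
    p^`M(k).@[x0 ord0] * q^`M(j).@[x0 ord0] != 0 ->
  exists2 c : R, 0 < c & exists2 h : R, 0 < h & forall x (a b a' b' : R),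
    near_by h (upd (upd x j a) k b) x0 -> near_by h (upd (upd x j a') k b') x0 ->
    c * (`|a - a'| + `|b - b'|) <=
    `|p.@[(upd (upd x j a) k b) ord0] - p.@[(upd (upd x j a') k b') ord0]| +
    `|q.@[(upd (upd x j a) k b) ord0] - q.@[(upd (upd x j a') k b') ord0]|.
Proof.
move=> kj; set al := p^`M(j).@[_]; set de := q^`M(k).@[_].
set be := p^`M(k).@[_]; set ga := q^`M(j).@[_] => D0.
pose D := `|al * de - be * ga|; have Dp : 0 < D by rewrite normr_gt0.
pose B := 1 + `|al| + `|be| + `|ga| + `|de|.
have [a0 b0 c0 d0] : [/\ 0 <= `|al|, 0 <= `|be|, 0 <= `|ga| & 0 <= `|de|] by [].
have Bp : 0 < B by rewrite /B; lra.
pose e := D / (8 * B); have ep : 0 < e by rewrite divr_gt0// mulr_gt0.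
have [h1 h10 H1] := meval_near p^`M(j) x0 _ ep.
have [h2 h20 H2] := meval_near p^`M(k) x0 _ ep.
have [h3 h30 H3] := meval_near q^`M(j) x0 _ ep.
have [h4 h40 H4] := meval_near q^`M(k) x0 _ ep.
exists (D / (4 * B)); first by rewrite divr_gt0// mulr_gt0.
pose h := Num.min (Num.min h1 h2) (Num.min h3 h4).
have [hh1 hh2 hh3 hh4] : [/\ h <= h1, h <= h2, h <= h3 & h <= h4].
  by rewrite /h !ge_min !lexx ?orbT.
exists h; first by rewrite /h !lt_min h10 h20 h30 h40.
move=> x a b a' b' hX hY.
have hW : near_by h (upd (upd x j a) k b') x0.
  move=> l; have := hX l; have := hY l; rewrite !mxE.
  by case: eqP => // _; case: eqP.
have w z g : near_by h z x0 -> h <= g -> near_by g z x0.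
  by move=> hz hg l; exact: le_trans (hz l) hg.
have split r : exists2 zj, near_by h zj x0 & exists2 zk, near_by h zk x0 &
    r.@[(upd (upd x j a) k b) ord0] - r.@[(upd (upd x j a') k b') ord0] =
    r^`M(j).@[zj ord0] * (a - a') + r^`M(k).@[zk ord0] * (b - b').
  have [zk hzk Ek] := meval_mvt r k _ x0 _ _ _ hX hW.
  have := hW; have := hY; rewrite !(updC x j) // => hY' hW'.
  have [zj hzj Ej] := meval_mvt r j _ x0 _ _ _ hW' hY'.
  by exists zj => //; exists zk => //; rewrite -Ej -Ek -!(updC x j) //; ring.
have [zj hzj [zk hzk ->]] := split p.
have [yj hyj [yk hyk ->]] := split q.
apply: (linear_lower_bound al be ga de _ _ _ _ _ _ e B D) => //; rewrite ?/B; try lra.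
- by apply: H1; exact: w hh1.
- by apply: H2; exact: w hh2.
- by apply: H3; exact: w hh3.
- by apply: H4; exact: w hh4.
- by rewrite /e mulrC divfK// gt_eqF// mulr_gt0.
Qed.

End PolynomialFunctions.

(** * Symbol calculus *)

Section CubeSupport.
Context {R : realType} {n : nat} (x0 : 'rV[R]_n) (delta : R).
Implicit Types (f g : 'rV[R]_n -> R) (x : 'rV[R]_n) (j k : 'I_n).
Local Notation K := (cube x0 delta).

Lemma cube_compact : compact K.
Proof.
pose A i := `[x0 ord0 i - delta, x0 ord0 i + delta]%classic.
rewrite (_ : K = [set v : 'rV[R]_n | forall i, A i (v ord0 i)]).
  by apply: rV_compact => i; exact: segment_compact.
apply/seteqP; split=> x /= xK i; have := xK i; rewrite /A /= in_itv/=;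
  by rewrite ler_distl.
Qed.

Lemma near_not_cube x : ~ K x -> \forall y \near x, ~ K y.
Proof.
move=> /existsNP[j /negP]; rewrite -ltNge => xj.
have r0 : 0 < `|x ord0 j - x0 ord0 j| - delta by rewrite subr_gt0.
apply/nbhs_ballP; exists (`|x ord0 j - x0 ord0 j| - delta) => // y [_ /(_ ord0 j)] xy.
rewrite /ball /= in xy.
move=> /(_ j) yj; have := ler_distD (y ord0 j) (x ord0 j) (x0 ord0 j).
lra.
Qed.

(** Continuity is asked only in the open unit cube because logarithms of the coordinates will occur.
    Off [K] the function vanishes in a neighbourhood, the complement of [K] being open. *)
Lemma nice_cube f : K `<=` ucube -> (forall x, ucube x -> {for x, continuous f}) ->
  (forall x, ~ K x -> f x = 0) -> nice f.
Proof.
move=> Ku fc f0; split; last by move=> x xu; apply: f0 => /Ku.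
apply: (ucont_compact _ K) => //; first exact: cube_compact.
move=> x; have [/Ku/fc//|nKx] := pselect (K x).
rewrite /prop_for /continuous_at (f0 x nKx).
apply: cvg_near_cst; first exact: (nbhs_filter x).
exact: (@filterS _ _ (nbhs_filter x) _ _ (fun y => f0 y) (near_not_cube _ nKx)).
Qed.

Variable varpi : 'rV[R]_n -> R.

Lemma fsupport_out : fsupport varpi `<=` K -> forall x, ~ K x -> varpi x = 0.
Proof.
move=> sK x nKx; apply/eqP; apply: contra_notT nKx => vx.
by apply: sK; exact: subset_closure.
Qed.

Lemma iter_partial_out (s : seq 'I_n) : fsupport varpi `<=` K ->
  forall x, ~ K x -> iter_partial s varpi x = 0.
Proof.
move=> sK; elim: s => [|k s IH] x nKx /=; first exact: fsupport_out.
rewrite /partial (@near_eq_derive _ _ _ _ (cst 0)) ?derive_cst//.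
exact: (@filterS _ _ (nbhs_filter x) _ _ (fun y => IH y) (near_not_cube _ nKx)).
Qed.

Lemma is_derive_iter_partial (s : seq 'I_n) k x : smooth varpi ->
  is_derive (x ord0 k) (1 : R) (fun y : R => iter_partial s varpi (upd x k y))
    (iter_partial (k :: s) varpi x).
Proof.
move=> /(_ s)[_ /(_ k x)]; rewrite /= /partial; set f := iter_partial s varpi => fd.
have E : (fun h : R => h^-1 *: (((fun y : R => f (upd x k y)) \o shift (x ord0 k)) (h *: (1 : R)) - f (upd x k (x ord0 k)))) =
  (fun h : R => h^-1 *: ((f \o shift x) (h *: delta_mx ord0 k) - f x)).
  apply/funext => h /=; rewrite upd_id; congr (_ *: (f _ - _)).
  apply/rowP => l; rewrite !mxE eqxx /= /GRing.scale/= mulr1.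
  by case: eqP => [->|_]; rewrite ?mulr1// mulr0 add0r.
by apply: DeriveDef; rewrite /derivable/derive E.
Qed.

Lemma iter_partial_bounded (s : seq 'I_n) : smooth varpi ->
  exists2 C : R, 0 <= C & forall x, K x -> `|iter_partial s varpi x| <= C.
Proof.
move=> /(_ s)[fc _].
have := compact_bounded (continuous_compact (continuous_subspaceT fc) cube_compact).
move=> [M [_ /(_ (`|M| + 1))]] H; exists (`|M| + 1); first by rewrite addr_ge0.
move=> x Kx; apply: H; last by exists x.
by rewrite (le_lt_trans (ler_norm _))// ltrDl.
Qed.

End CubeSupport.

Section ContinuityAt.
Context {R : realType} {n : nat}.
Local Notation T := 'rV[R]_n.
Implicit Types (f g : T -> R) (x : T).

Lemma contD f g x : {for x, continuous f} -> {for x, continuous g} ->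
  {for x, continuous (fun y => f y + g y)}.
Proof. exact: continuousD. Qed.

Lemma contM f g x : {for x, continuous f} -> {for x, continuous g} ->
  {for x, continuous (fun y => f y * g y)}.
Proof. exact: continuousM. Qed.

Lemma contC (c : R) x : {for x, continuous (fun _ : T => c)}.
Proof. exact: cst_continuous. Qed.

Lemma cont_comp (h : R -> R) f x : {for x, continuous f} ->
  {for f x, continuous h} -> {for x, continuous (fun y => h (f y))}.
Proof. exact: continuous_comp. Qed.

Lemma cont_sum I (s : seq I) (f : I -> T -> R) x :
  (forall i, {for x, continuous (f i)}) ->
  {for x, continuous (fun y => \sum_(i <- s) f i y)}.
Proof.
move=> fc; elim: s => [|i s IH].
  by rewrite (_ : (fun y => _) = fun=> 0); [exact: contC|apply/funext => y; rewrite big_nil].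
rewrite (_ : (fun y => _) = fun y => f i y + \sum_(i <- s) f i y); first exact: contD.
by apply/funext => y; rewrite big_cons.
Qed.

End ContinuityAt.

(** * Amplitudes as formal expressions, their degrees and derivatives *)

Section Symbols.
Context {R : realType} {n : nat}.
Variables (varpi : 'rV[R]_n -> R) (Q1 Q2 : {mpoly R[n]}).
Implicit Types (x : 'rV[R]_n) (k : 'I_n).

(* Amplitudes as syntax: differentiation is then a function on terms, and the
   constants in the bounds depend on the term only, not on the parameters. *)
Inductive sym : Type :=
| Sg | Ga | Gb | Ep
| Po of {mpoly R[n]} | Vp of seq 'I_n | Rk of 'I_n | Mo
| Add of sym & sym | Mul of sym & sym | Sum of ('I_n -> sym).

(** [T1] and [T2] stand for [sum_k t_k] and [t_j]; an amplitude sees [t] only through these two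
    numbers. *)
Record par := Par { tau : R; T1 : R; T2 : R; rr : 'I_n -> R }.

Section Eval.
Variable P : par.

Definition ep : R := (Num.sqrt (tau P))^-1.
Definition q1 x : R := ep * (tau P * Q1.@[x ord0] + T1 P).
Definition q2 x : R := ep * (tau P * Q2.@[x ord0] + T2 P).
Definition sg x : R := (1 + q1 x ^+ 2 + q2 x ^+ 2)^-1.
(** For positive coordinates this is the weight [prod_k x_k^(r_k)]. *)
Definition mo x : R := expR (\sum_k rr P k * ln (x ord0 k)).

Fixpoint ev (e : sym) x : R :=
  match e with
  | Sg => sg x
  | Ga => q1 x * sg x
  | Gb => q2 x * sg x
  | Ep => ep
  | Po p => p.@[x ord0]
  | Vp s => iter_partial s varpi x
  | Rk k => rr P k
  | Mo => mo x
  | Add a b => ev a x + ev b x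
  | Mul a b => ev a x * ev b x
  | Sum f => \sum_k ev (f k) x
  end.

End Eval.

(** The logarithmic derivative of [sg] along [tau^(-1/2) x_k d/dx_k] is [-2] times this symbol. *)
Definition gh k := Add (Mul Ga (Po (logderiv k Q1))) (Mul Gb (Po (logderiv k Q2))).

(* [dk k e] is [tau^(-1/2) x_k d/dx_k e]; the zeros are written so that their
   degree in the sense of [isdeg] is the expected one. *)
Fixpoint dk k (e : sym) : sym :=
  match e with
  | Sg => Mul (Po (-2)%:MP) (Mul Sg (gh k))
  | Ga => Add (Mul (Po (logderiv k Q1)) Sg) (Mul (Po (-2)%:MP) (Mul Ga (gh k)))
  | Gb => Add (Mul (Po (logderiv k Q2)) Sg) (Mul (Po (-2)%:MP) (Mul Gb (gh k)))
  | Ep => Mul (Po 0) (Mul Ep Ep)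
  | Po p => Mul Ep (Po (logderiv k p))
  | Vp s => Mul Ep (Mul (Po 'X_k) (Vp (k :: s)))
  | Rk _ => Mul (Po 0) Ep
  | Mo => Mul Ep (Mul (Rk k) Mo)
  | Add a b => Add (dk k a) (dk k b)
  | Mul a b => Add (Mul (dk k a) b) (Mul a (dk k b))
  | Sum f => Sum (fun l => dk k (f l))
  end.

(** The degree counts the powers of [sqrt sg + ep] that control the size of a symbol; [q_i sg]
    counts like [sqrt sg]. *)
Inductive isdeg : nat -> sym -> Prop :=
| deg_Sg : isdeg 2 Sg
| deg_Ga : isdeg 1 Ga
| deg_Gb : isdeg 1 Gb
| deg_Ep : isdeg 1 Ep
| deg_Po p : isdeg 0 (Po p)
| deg_Vp s : isdeg 0 (Vp s)
| deg_Rk k : isdeg 0 (Rk k)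
| deg_Mo : isdeg 0 Mo
| deg_Add m a b : isdeg m a -> isdeg m b -> isdeg m (Add a b)
| deg_Mul m1 m2 a b : isdeg m1 a -> isdeg m2 b -> isdeg (m1 + m2) (Mul a b)
| deg_Sum m f : (forall k, isdeg m (f k)) -> isdeg m (Sum f).

Lemma deg_gh k : isdeg 1 (gh k).
Proof. by apply: deg_Add; apply: (deg_Mul 1 0); constructor. Qed.

(** The factor [tau^(-1/2)] built into [dk] turns the derivatives of [q1] and [q2] into polynomials,
    so [Sg] gains a factor [gh] of degree one; on slowly varying factors it shows up as [Ep]. *)
Lemma deg_dk k m e : isdeg m e -> isdeg m.+1 (dk k e).
Proof.
elim=> {m e} /=.
- by apply: (deg_Mul 0 3); [constructor|apply: (deg_Mul 2 1); [constructor|exact: deg_gh]].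
- apply: deg_Add; first by apply: (deg_Mul 0 2); constructor.
  by apply: (deg_Mul 0 2); [constructor|apply: (deg_Mul 1 1); [constructor|exact: deg_gh]].
- apply: deg_Add; first by apply: (deg_Mul 0 2); constructor.
  by apply: (deg_Mul 0 2); [constructor|apply: (deg_Mul 1 1); [constructor|exact: deg_gh]].
- by apply: (deg_Mul 0 2); [constructor|apply: (deg_Mul 1 1); constructor].
- by move=> p; apply: (deg_Mul 1 0); constructor.
- by move=> s; apply: (deg_Mul 1 0); [constructor|apply: (deg_Mul 0 0); constructor].
- by move=> l; apply: (deg_Mul 0 1); constructor.
- by apply: (deg_Mul 1 0); [constructor|apply: (deg_Mul 0 0); constructor].
- by move=> m a b _ IHa _ IHb; exact: deg_Add.
- move=> m1 m2 a b Ha IHa Hb IHb; apply: deg_Add; first exact: (deg_Mul m1.+1 m2).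
  by rewrite -addnS; exact: deg_Mul.
- by move=> m f _ IH; exact: deg_Sum.
Qed.

(** A syntactic guarantee of vanishing off the support of [varpi]: every summand must carry a factor
    [Vp]. *)
Fixpoint supp (e : sym) : bool :=
  match e with
  | Vp _ => true
  | Add a b => supp a && supp b
  | Mul a b => supp a || supp b
  | Sum f => [forall k, supp (f k)]
  | _ => false
  end.

Lemma supp_dk k e : supp e -> supp (dk k e).
Proof.
elim: e => //= [a IHa b IHb /andP[/IHa -> /IHb ->]//|a IHa b IHb|f IH /forallP H].
  by move=> /orP[/[dup]/IHa -> ->|/[dup]/IHb -> ->]; rewrite ?orbT.
by apply/forallP => l; exact: IH.
Qed.

Lemma ev_out P (x0 : 'rV[R]_n) (delta : R) e x : fsupport varpi `<=` cube x0 delta ->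
  supp e -> ~ cube x0 delta x -> ev P e x = 0.
Proof.
move=> sK + nKx; elim: e => //= [s _|a IHa b IHb|a IHa b IHb|f IH /forallP H].
- exact: iter_partial_out nKx.
- by move=> /andP[/IHa -> /IHb ->]; rewrite addr0.
- by move=> /orP[/IHa|/IHb] ->; rewrite (mul0r, mulr0).
- by apply: big1 => k _; exact: IH.
Qed.

Lemma sg_den_gt0 P x : 0 < 1 + q1 P x ^+ 2 + q2 P x ^+ 2.
Proof. by rewrite -addrA ltr_pwDl// addr_ge0// sqr_ge0. Qed.

Lemma q1_continuous P x : {for x, continuous (q1 P)}.
Proof.
apply: (@contM _ _ (fun=> ep P) (fun y => tau P * Q1.@[y ord0] + T1 P)); first exact: contC.
apply: (@contD _ _ (fun y => tau P * Q1.@[y ord0]) (fun=> T1 P)); last exact: contC.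
by apply: (@contM _ _ (fun=> tau P) (fun y => Q1.@[y ord0])); [exact: contC|exact: continuous_meval].
Qed.

Lemma q2_continuous P x : {for x, continuous (q2 P)}.
Proof.
apply: (@contM _ _ (fun=> ep P) (fun y => tau P * Q2.@[y ord0] + T2 P)); first exact: contC.
apply: (@contD _ _ (fun y => tau P * Q2.@[y ord0]) (fun=> T2 P)); last exact: contC.
by apply: (@contM _ _ (fun=> tau P) (fun y => Q2.@[y ord0])); [exact: contC|exact: continuous_meval].
Qed.

Lemma sg_continuous P x : {for x, continuous (sg P)}.
Proof.
apply: (@continuousV _ _ (fun x => 1 + q1 P x ^+ 2 + q2 P x ^+ 2)).
  by rewrite gt_eqF// sg_den_gt0.
apply: (@contD _ _ (fun y => 1 + q1 P y ^+ 2) (fun y => q2 P y ^+ 2)); last first.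
  by apply: (@contM _ _ (q2 P) (q2 P)); exact: q2_continuous.
apply: (@contD _ _ (fun=> 1) (fun y => q1 P y ^+ 2)); first exact: contC.
by apply: (@contM _ _ (q1 P) (q1 P)); exact: q1_continuous.
Qed.

Lemma ev_continuous P e x : smooth varpi -> ucube x -> {for x, continuous (ev P e)}.
Proof.
move=> sv xu; elim: e => /=.
- exact: sg_continuous.
- by apply: contM; [exact: q1_continuous|exact: sg_continuous].
- by apply: contM; [exact: q2_continuous|exact: sg_continuous].
- exact: contC.
- by move=> p; exact: continuous_meval.
- by move=> s; have [] := sv s => + _; apply.
- by move=> k; exact: contC.
- apply: cont_comp; last exact: continuous_expR.
  apply: cont_sum => k; apply: contM; first exact: contC.
  apply: cont_comp; first exact: coord_continuous.
  by apply: continuous_ln; have /andP[] := xu k.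
- by move=> a IHa b IHb; exact: contD.
- by move=> a IHa b IHb; exact: contM.
- by move=> f IH; exact: cont_sum.
Qed.

Lemma is_derive_ln_coord k l x : ucube x ->
  is_derive (x ord0 k) (1 : R) (fun y : R => ln ((upd x k y) ord0 l))
   (if l == k then (x ord0 k)^-1 else 0).
Proof.
move=> xu; under eq_fun do rewrite mxE.
case: eqP => // _; last exact: der_cst.
by apply: is_derive1_ln; have /andP[] := xu k.
Qed.

Lemma is_derive_logsum (c : 'I_n -> R) k x : ucube x ->
  is_derive (x ord0 k) (1 : R)
   (fun y : R => \sum_l c l * ln ((upd x k y) ord0 l)) (c k / x ord0 k).
Proof.
move=> xu.
have -> : c k / x ord0 k = \sum_l (0 * ln ((upd x k (x ord0 k)) ord0 l) +
    c l * (if l == k then (x ord0 k)^-1 else 0)).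
  rewrite (bigD1 k)//= eqxx mul0r add0r big1 ?addr0// => l /negbTE ->.
  by rewrite mul0r mulr0 addr0.
apply: der_sum => l.
exact: (der_mul _ _ _ _ _ (der_cst (x ord0 k) (c l)) (is_derive_ln_coord k l x xu)).
Qed.

Section Derivative.
Variables (P : par).
Hypothesis tau0 : 0 < tau P.

Lemma ep_gt0 : 0 < ep P.
Proof. by rewrite invr_gt0 sqrtr_gt0. Qed.

Lemma ep_tau : ep P * tau P = (ep P)^-1.
Proof. by rewrite /ep invrK -{2}(sqr_sqrtr (ltW tau0)) expr2 mulKf// gt_eqF// sqrtr_gt0. Qed.

(** Since [ep * tau = 1 / ep] and the constant [T] drops out, the scaled derivatives of [q1] and
    [q2] are fixed polynomials, free of [tau] and [t]. *)
Lemma is_derive_affine (Q : {mpoly R[n]}) (T : R) k x : ucube x ->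
  is_derive (x ord0 k) (1 : R)
    (fun y : R => ep P * (tau P * Q.@[(upd x k y) ord0] + T))
    ((logderiv k Q).@[x ord0] / (ep P * x ord0 k)).
Proof.
move=> xu; have xk : x ord0 k != 0 by have /andP[/gt_eqF ->] := xu k.
have e0 := ep_gt0.
have D := is_derive_meval Q k x.
have := der_mul _ _ _ _ _ (der_cst (x ord0 k) (ep P))
  (der_add _ _ _ _ _ (der_mul _ _ _ _ _ (der_cst (x ord0 k) (tau P)) D) (der_cst (x ord0 k) T)).
move/is_derive_eq; apply; rewrite !mul0r !add0r addr0 mulrA ep_tau /logderiv mevalM mevalXU.
by field; rewrite xk gt_eqF.
Qed.

Lemma is_derive_ev e k x : smooth varpi -> ucube x ->
  is_derive (x ord0 k) (1 : R) (fun y : R => ev P e (upd x k y))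
    (ev P (dk k e) x / (ep P * x ord0 k)).
Proof.
move=> sv xu; have xk : x ord0 k != 0 by have /andP[/gt_eqF ->] := xu k.
have e0 : ep P != 0 by rewrite gt_eqF// ep_gt0.
have Dq1 := is_derive_affine Q1 (T1 P) k x xu.
have Dq2 := is_derive_affine Q2 (T2 P) k x xu.
have s0 : 1 + q1 P x ^+ 2 + q2 P x ^+ 2 != 0 by rewrite gt_eqF// sg_den_gt0.
have Dsg : is_derive (x ord0 k) (1 : R) (fun y : R => sg P (upd x k y))
    (ev P (dk k Sg) x / (ep P * x ord0 k)).
  have := der_inv _ _ _ _ (der_add _ _ _ _ _ (der_add _ _ _ _ _
    (der_cst (x ord0 k) 1) (der_mul _ _ _ _ _ Dq1 Dq1)) (der_mul _ _ _ _ _ Dq2 Dq2)).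
  rewrite /= upd_id -/(q1 P x) -/(q2 P x) => /(_ s0) /is_derive_eq; apply.
  rewrite mevalC /sg; move: s0; set a := q1 P x; set b := q2 P x => s0.
  by field; rewrite s0 e0 xk.
elim: e => //=.
- have := der_mul _ _ _ _ _ Dq1 Dsg; rewrite /= upd_id -/(q1 P x).
  move/is_derive_eq; apply; rewrite /= mevalC.
  by set a := q1 P x; field; rewrite e0 xk.
- have := der_mul _ _ _ _ _ Dq2 Dsg; rewrite /= upd_id -/(q2 P x).
  move/is_derive_eq; apply; rewrite /= mevalC.
  by set a := q2 P x; field; rewrite e0 xk.
- by rewrite meval0 !mul0r; exact: der_cst.
- move=> p; have := is_derive_meval p k x.
  move/is_derive_eq; apply; rewrite /logderiv mevalM mevalXU.
  by field; rewrite e0 xk.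
- move=> s; have := is_derive_iter_partial varpi s k x sv.
  by move/is_derive_eq; apply; rewrite mevalXU /=; field; rewrite e0 xk.
- by move=> l; rewrite meval0 !mul0r; exact: der_cst.
- have := der_comp _ _ _ _ _ (is_derive_logsum (rr P) k x xu) (is_derive_expR _).
  move/is_derive_eq; apply; rewrite /= upd_id -/(mo P x).
  by field; rewrite e0 xk.
- by move=> a IHa b IHb; rewrite mulrDl; exact: der_add.
- move=> a IHa b IHb; have := der_mul _ _ _ _ _ IHa IHb; rewrite /= upd_id.
  by move/is_derive_eq; apply; field; rewrite e0 xk.
- by move=> f IH; rewrite mulr_suml; exact: der_sum.
Qed.

End Derivative.

End Symbols.

(** * Size of the symbols *)

Section GridSums.
Context {R : realType}.

(** A discrete counterpart of the integral of [1 / (1 + (h u)^2)] over the line, which is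
    [pi / h]. *)
Lemma inv_sqr_sum_le (h : R) (N m : nat) : 0 < h <= 1 ->
  \sum_(a < N) (1 + (h * (a%:R - m%:R)) ^+ 2)^-1 <= 8 / h.
Proof.
move=> /andP[h0 h1].
(* The terms are dominated by the increments of this bounded function. *)
pose ps (u : R) := u / (1 + h * `|u|).
have den (u : R) : 0 < 1 + h * `|u| by rewrite ltr_pwDl// mulr_ge0// ltW.
have ps_le u : `|ps u| <= h^-1.
  rewrite normrM normfV (gtr0_norm (den u)) ler_pdivrMr// mulrDr mulr1 mulKf ?gt_eqF//.
  by rewrite lerDr invr_ge0 ltW.
(* A unit step changes [ps] by the inverse of [(1 + h u) (1 + h u')], where [u] and [u'] are the
   distances of its ends from [m]. This product is at most [4 (1 + (h (a - m))^2)]; to the right of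
   [m] this uses [h <= 1]. *)
have incr a : (1 + (h * (a%:R - m%:R)) ^+ 2)^-1 <=
    4 * (ps (a.+1%:R - m%:R) - ps (a%:R - m%:R)).
  have d0 : 0 < 1 + (h * (a%:R - m%:R)) ^+ 2 by rewrite ltr_pwDl// sqr_ge0.
  have [ma|am] := leqP m a.
    have -> : a.+1%:R - m%:R = a%:R - m%:R + 1 :> R by rewrite -natr1; ring.
    have u0 : 0 <= a%:R - m%:R :> R by rewrite subr_ge0 ler_nat.
    move: d0; set u := a%:R - m%:R in u0 *; move=> d0.
    have v0 : 0 <= u + 1 by lra.
    rewrite /ps !ger0_norm//.
    have e1 : 0 < 1 + h * u by rewrite ltr_pwDl// mulr_ge0// ltW.
    have e2 : 0 < 1 + h * (u + 1) by rewrite ltr_pwDl// mulr_ge0// ltW.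
    have -> : (u + 1) / (1 + h * (u + 1)) - u / (1 + h * u) =
        ((1 + h * (u + 1)) * (1 + h * u))^-1 by field; rewrite !gt_eqF.
    rewrite -div1r ler_pdivrMr// mulrAC ler_pdivlMr ?mulr_gt0// mul1r.
    have w0 : 0 <= h * u by rewrite mulr_ge0// ltW.
    rewrite (_ : h * (u + 1) = h * u + h); last by ring.
    move: w0; set w := h * u => w0.
    have := sqr_ge0 (w - 2^-1); have : h * (1 + w) <= 1 * (1 + w) by rewrite ler_wpM2r// addr_ge0.
    nra.
  have -> : a%:R - m%:R = - (m%:R - a%:R) :> R by ring.
  have -> : a.+1%:R - m%:R = - (m%:R - a%:R - 1) :> R by rewrite -natr1; ring.
  have v1 : 1 <= m%:R - a%:R :> R.
    by rewrite lerBrDr addrC natr1 ler_nat.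
  set v := m%:R - a%:R in v1 *.
  have v0 : 0 <= v by lra.
  have v10 : 0 <= v - 1 by lra.
  rewrite /ps !normrN (ger0_norm v0) (ger0_norm v10) mulrN sqrrN.
  have e1 : 0 < 1 + h * v by rewrite ltr_pwDl// mulr_ge0// ltW.
  have e2 : 0 < 1 + h * (v - 1) by rewrite ltr_pwDl// mulr_ge0// ltW.
  have -> : - (v - 1) / (1 + h * (v - 1)) - - v / (1 + h * v) =
      ((1 + h * (v - 1)) * (1 + h * v))^-1 by field; rewrite !gt_eqF.
  have d1 : 0 < 1 + (h * v) ^+ 2 by rewrite ltr_pwDl// sqr_ge0.
  rewrite -div1r ler_pdivrMr// mulrAC ler_pdivlMr ?mulr_gt0// mul1r.
  have w0 : 0 <= h * v by rewrite mulr_ge0// ltW.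
  rewrite (_ : h * (v - 1) = h * v - h); last by ring.
  move: w0; set w := h * v => w0.
  have := sqr_ge0 (w - 1); have : 0 <= h * (1 + w) by rewrite mulr_ge0 ?addr_ge0// ltW.
  nra.
apply: (@le_trans _ _ (4 * (ps (N%:R - m%:R) - ps (0%:R - m%:R)))).
  rewrite -(telescope_sumr (fun a : nat => ps (a%:R - m%:R)) (leq0n N)) big_mkord mulr_sumr.
  by apply: ler_sum => a _; exact: incr.
have := ps_le (N%:R - m%:R); have := ps_le (0%:R - m%:R).
by rewrite !ler_norml => /andP[? ?] /andP[? ?]; lra.
Qed.

(** The previous sum with [h = sqrt kap / (N + 1)]; the lower bound on [N] says that [h <= 1]. *)
Lemma inv_sqr_avg_le (kap : R) (N m : nat) : 0 < kap -> Num.sqrt kap <= N.+1%:R ->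
  N.+1%:R^-1 * \sum_(a < N.+1) (1 + kap * (gpt N a - gpt N m) ^+ 2)^-1 <=
  8 / Num.sqrt kap.
Proof.
move=> k0 kN; have N0 : 0 < N.+1%:R :> R by rewrite ltr0Sn.
have s0 : 0 < Num.sqrt kap by rewrite sqrtr_gt0.
have h01 : 0 < Num.sqrt kap / N.+1%:R <= 1.
  by rewrite divr_gt0//= ler_pdivrMr// mul1r.
have := inv_sqr_sum_le _ N.+1 m h01.
under eq_bigr => a _.
  have -> : (Num.sqrt kap / N.+1%:R * (a%:R - m%:R)) ^+ 2 = kap * (gpt N a - gpt N m) ^+ 2.
    have -> : gpt N a - gpt N m = (a%:R - m%:R) / N.+1%:R :> R by rewrite /gpt; ring.
    by rewrite -{2}(sqr_sqrtr (ltW k0)); ring.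
  over.
rewrite ler_pdivrMl// => H; apply: (le_trans H).
by rewrite invfM invrK le_eqVlt; apply/orP; left; apply/eqP; field; rewrite gt_eqF.
Qed.

End GridSums.

(** * Bounds for symbols and their integrals, uniform in the parameters *)

Section SymbolBounds.
Context {R : realType} {n : nat}.
Variables (varpi : 'rV[R]_n -> R) (Q1 Q2 : {mpoly R[n]}) (x0 : 'rV[R]_n) (delta : R).
Hypothesis sv : smooth varpi.
Hypothesis supv : fsupport varpi `<=` cube x0 delta.
Variable l : R.
Hypothesis l0 : 0 < l.
Hypothesis Kl : forall x, cube x0 delta x -> forall k, l <= x ord0 k < 1.
Variable B : R.
Hypothesis B0 : 0 <= B.
Implicit Types (x : 'rV[R]_n) (P : @par R n) (e : @sym R n).
Local Notation ev := (ev varpi Q1 Q2).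
Local Notation sg := (sg Q1 Q2).

Lemma cube_ucube : cube x0 delta `<=` ucube.
Proof. by move=> x /Kl H k; have /andP[/(lt_le_trans l0) ->] := H k. Qed.

(** [T1] and [T2] range freely here, so a bound over all admissible parameters is uniform in [t]. *)
Definition admissible P := 1 <= tau P /\ forall k, `|rr P k| <= B.

Lemma ep_le1 P : admissible P -> 0 < ep P <= 1.
Proof.
move=> [t1 _]; have t0 : 0 < tau P by rewrite (lt_le_trans _ t1).
by rewrite ep_gt0//= invf_le1 ?sqrtr_gt0// -sqrtr1 ler_wsqrtr.
Qed.

Lemma sg_itv P x : 0 < sg P x <= 1.
Proof.
rewrite invr_gt0 sg_den_gt0 /= invf_le1 ?sg_den_gt0//.
by rewrite -addrA lerDl addr_ge0 ?sqr_ge0.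
Qed.

Definition om P x : R := Num.sqrt (sg P x) + ep P.

(** From [q_i^2 sg <= 1] follows [(q_i sg)^2 <= sg]. *)
Lemma norm_q_sg P x : `|q1 Q1 P x * sg P x| <= Num.sqrt (sg P x) /\
  `|q2 Q2 P x * sg P x| <= Num.sqrt (sg P x).
Proof.
have /andP[s0 _] := sg_itv P x; have := sg_den_gt0 Q1 Q2 P x => d0.
by split; rewrite -sqrtr_sqr ler_wsqrtr// exprMn expr2 mulrA ger_pMl//
  /sg ler_pdivrMr// mul1r ?lerDr ?addr_ge0 ?sqr_ge0// -addrA [X in _ <= 1 + X]addrC addrA lerDr addr_ge0 ?sqr_ge0.
Qed.

Lemma mo_bound : exists C : R, 0 <= C /\ forall P, admissible P ->
  forall x, cube x0 delta x -> `|mo P x| <= C.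
Proof.
exists (expR (\sum_(k < n) B * `|ln l|)); split; first exact: expR_ge0.
move=> P [_ hr] x Kx; rewrite ger0_norm ?expR_ge0// ler_expR.
apply: ler_sum => k _; apply: (le_trans (ler_norm _)); rewrite normrM ler_pM//.
have /andP[lx x1] := Kl _ Kx k.
have xp : 0 < x ord0 k by rewrite (lt_le_trans l0).
have hx : ln (x ord0 k) <= 0 by rewrite ln_le0// ltW.
have hl : ln l <= ln (x ord0 k) by rewrite ler_ln// posrE.
by rewrite (ler0_norm hx) ler0_norm ?lerN2// (le_trans hl).
Qed.

(** Induction on the derivation of the degree: products multiply the powers of [om], and sums keep
    them. The constant is found from the term before any parameter is introduced; a [Sum] requires
    choosing one constant per index. *)
Lemma ev_bound m e : isdeg m e -> exists C : R, 0 <= C /\ forall P, admissible P ->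
  forall x, cube x0 delta x -> `|ev P e x| <= C * om P x ^+ m.
Proof.
have om0 P x : admissible P -> 0 <= om P x.
  by move=> /ep_le1/andP[/ltW e0 _]; rewrite addr_ge0// sqrtr_ge0.
have omG P x (z : R) : admissible P -> `|z| <= Num.sqrt (sg P x) -> `|z| <= 1 * om P x ^+ 1.
  move=> /ep_le1/andP[/ltW e0 _] /le_trans; apply.
  by rewrite mul1r expr1 lerDl.
elim=> {m e}.
- exists 1; split=> // P aP x Kx; have /andP[s0 _] := sg_itv P x.
  rewrite mul1r /= ger0_norm ?(ltW s0)// -[leLHS](sqr_sqrtr (ltW s0)).
  have /andP[/ltW e0 _] := ep_le1 _ aP.
  by rewrite ler_pXn2r ?nnegrE ?om0 ?sqrtr_ge0// lerDl.
- by exists 1; split=> // P aP x Kx; apply: omG => //; case: (norm_q_sg P x).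
- by exists 1; split=> // P aP x Kx; apply: omG => //; case: (norm_q_sg P x).
- exists 1; split=> // P aP x Kx; have /andP[/ltW e0 _] := ep_le1 _ aP.
  by rewrite mul1r expr1 /= ger0_norm// lerDr sqrtr_ge0.
- move=> p; have [C C0 HC] := meval_bounded p; exists C; split=> // P aP x Kx.
  by rewrite expr0 mulr1; apply: HC; exact: cube_ucube.
- move=> s; have [C C0 HC] := iter_partial_bounded x0 delta varpi s sv.
  by exists C; split=> // P aP x Kx; rewrite expr0 mulr1; exact: HC.
- by move=> k; exists B; split=> // P [_ hr] x Kx; rewrite expr0 mulr1; exact: hr.
- have [C [C0 HC]] := mo_bound; exists C; split=> // P aP x Kx.
  by rewrite expr0 mulr1; exact: HC.
- move=> m a b _ [C [C0 HC]] _ [D [D0 HD]]; exists (C + D); split; first exact: addr_ge0.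
  move=> P aP x Kx; rewrite mulrDl (le_trans (ler_normD _ _))//.
  by rewrite lerD ?HC ?HD.
- move=> m1 m2 a b _ [C [C0 HC]] _ [D [D0 HD]]; exists (C * D); split; first exact: mulr_ge0.
  move=> P aP x Kx; rewrite exprD mulrACA /= normrM.
  by rewrite ler_pM ?HC ?HD.
- move=> m f _ /choice[C HC]; exists (\sum_k C k); split.
    by apply: sumr_ge0 => k _; case: (HC k).
  move=> P aP x Kx; rewrite mulr_suml /= (le_trans (ler_norm_sum _ _ _))//.
  by apply: ler_sum => k _; case: (HC k) => _; apply.
Qed.

Definition ind x : R := if `[< cube x0 delta x >] then 1 else 0.

Variables (j k : 'I_n) (c : R).
Hypothesis c0 : 0 < c.
Hypothesis bil : forall x (a b a' b' : R),
  near_by delta (upd (upd x j a) k b) x0 -> near_by delta (upd (upd x j a') k b') x0 ->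
  c * (`|a - a'| + `|b - b'|) <=
  `|Q1.@[(upd (upd x j a) k b) ord0] - Q1.@[(upd (upd x j a') k b') ord0]| +
  `|Q2.@[(upd (upd x j a) k b) ord0] - Q2.@[(upd (upd x j a') k b') ord0]|.

(** As [|q1| + |q2|] is no larger at [Y] than at [X], the variation of [(q1, q2)] between them is at
    most twice its size at [X], while the bi-Lipschitz bound makes it at least [c s / ep]. Hence
    [q1^2 + q2^2 >= tau c^2 s^2 / 8] at [X], and one factor [sg] is spent on each coordinate. *)
Lemma sg_decay P x (a b a' b' : R) : admissible P ->
  let X := upd (upd x j a) k b in let Y := upd (upd x j a') k b' in
  cube x0 delta X -> cube x0 delta Y ->
  `|q1 Q1 P Y| + `|q2 Q2 P Y| <= `|q1 Q1 P X| + `|q2 Q2 P X| ->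
  sg P X ^+ 2 <= (1 + tau P * (c ^+ 2 / 8) * (a - a') ^+ 2)^-1 *
    (1 + tau P * (c ^+ 2 / 8) * (b - b') ^+ 2)^-1.
Proof.
move=> aP X Y KX KY hmin; have [t1 _] := aP.
have t0 : 0 < tau P by rewrite (lt_le_trans _ t1).
have /andP[e0 _] := ep_le1 _ aP.
have H := bil _ _ _ _ _ KX KY; rewrite -/X -/Y in H.
set s := `|a - a'| + `|b - b'| in H.
have s0 : 0 <= s by rewrite addr_ge0.
have D1 : `|q1 Q1 P X - q1 Q1 P Y| = (ep P)^-1 * `|Q1.@[X ord0] - Q1.@[Y ord0]|.
  rewrite -ep_tau// -[in RHS](@ger0_norm _ (ep P * tau P)) ?mulr_ge0 ?ltW// -normrM.
  by congr `|_|; rewrite /q1; ring.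
have D2 : `|q2 Q2 P X - q2 Q2 P Y| = (ep P)^-1 * `|Q2.@[X ord0] - Q2.@[Y ord0]|.
  rewrite -ep_tau// -[in RHS](@ger0_norm _ (ep P * tau P)) ?mulr_ge0 ?ltW// -normrM.
  by congr `|_|; rewrite /q2; ring.
have H2 : (ep P)^-1 * (c * s) <= 2 * (`|q1 Q1 P X| + `|q2 Q2 P X|).
  apply: (@le_trans _ _ (`|q1 Q1 P X - q1 Q1 P Y| + `|q2 Q2 P X - q2 Q2 P Y|)).
    by rewrite D1 D2 -mulrDr ler_wpM2l// invr_ge0 ltW.
  have := ler_normB (q1 Q1 P X) (q1 Q1 P Y); have := ler_normB (q2 Q2 P X) (q2 Q2 P Y).
  lra.
have H3 : tau P * (c ^+ 2 / 8) * s ^+ 2 <= q1 Q1 P X ^+ 2 + q2 Q2 P X ^+ 2.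
  have : ((ep P)^-1 * (c * s)) ^+ 2 <= (2 * (`|q1 Q1 P X| + `|q2 Q2 P X|)) ^+ 2.
    by rewrite ler_pXn2r// nnegrE ?mulr_ge0 ?addr_ge0 ?invr_ge0 ?(ltW e0) ?(ltW c0).
  have -> : ((ep P)^-1 * (c * s)) ^+ 2 = 8 * (tau P * (c ^+ 2 / 8) * s ^+ 2).
    by rewrite exprMn /ep invrK sqr_sqrtr ?(ltW t0)//; field.
  rewrite -[q1 Q1 P X ^+ 2]real_normK ?num_real// -[q2 Q2 P X ^+ 2]real_normK ?num_real//.
  set y := `|q1 Q1 P X|; set z := `|q2 Q2 P X| => h8.
  have : 0 <= (y - z) ^+ 2 by exact: sqr_ge0.
  nra.
have kp : 0 <= tau P * (c ^+ 2 / 8) by rewrite mulr_ge0 ?(ltW t0)// divr_ge0 ?sqr_ge0.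
have sub (u : R) : `|u| <= s -> sg P X <= (1 + tau P * (c ^+ 2 / 8) * u ^+ 2)^-1.
  move=> us; rewrite lef_pV2 ?posrE ?sg_den_gt0//; last first.
    by rewrite ltr_pwDl// mulr_ge0// sqr_ge0.
  rewrite -addrA lerD2l (le_trans _ H3)// ler_wpM2l//.
  by rewrite -real_normK ?num_real// ler_pXn2r// nnegrE.
have /andP[/ltW sg0 _] := sg_itv P X.
by rewrite expr2 ler_pM//; apply: sub; rewrite /s ?lerDl ?lerDr.
Qed.

(** With the other coordinates fixed, the grid in directions [j] and [k] is compared with its point
    of the cube where [|q1| + |q2|] is smallest. The double mean then factors into two
    one-dimensional ones, giving [(8 / sqrt kap)^2 = 512 / (c^2 tau)]. *)
Lemma rsum_sg2_le P N : admissible P ->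
  Num.sqrt (tau P * (c ^+ 2 / 8)) <= N.+1%:R ->
  rsum N n (fun x => sg P x ^+ 2 * ind x) <= 512 / c ^+ 2 / tau P.
Proof.
move=> aP hN; have [t1 _] := aP.
have t0 : 0 < tau P by rewrite (lt_le_trans _ t1).
have kp : 0 < tau P * (c ^+ 2 / 8) by rewrite mulr_gt0// divr_gt0// exprn_gt0.
set kap := tau P * (c ^+ 2 / 8) in hN kp.
set f := fun x => sg P x ^+ 2 * ind x.
have C0 : 0 <= 512 / c ^+ 2 / tau P by rewrite !divr_ge0 ?sqr_ge0 ?ltW.
have f0 x : 0 <= f x.
  by rewrite mulr_ge0 ?sqr_ge0// /ind; case: ifP.
rewrite (rsum_avg _ _ k) (rsum_avg _ _ j) (le_trans (ler_norm _))//.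
apply: ler_norm_rsum => x _.
pose X (p : 'I_N.+1 * 'I_N.+1) := upd (upd x j (gpt N p.1)) k (gpt N p.2).
pose S (p : 'I_N.+1 * 'I_N.+1) := `[< cube x0 delta (X p) >].
have -> : avg N j (avg N k f) x = N.+1%:R^-1 * \sum_(a < N.+1) (N.+1%:R^-1 * \sum_(b < N.+1) f (X (a, b))) by [].
rewrite ger0_norm; last first.
  rewrite mulr_ge0 ?invr_ge0// sumr_ge0// => a _.
  by rewrite mulr_ge0 ?invr_ge0// sumr_ge0.
have [p0 Sp0|S0] := pickP S; last first.
  rewrite big1 ?mulr0// => a _; rewrite big1 ?mulr0// => b _.
  by rewrite /f /ind -[`[< _ >]]/(S (a, b)) S0 mulr0.
pose M (p : 'I_N.+1 * 'I_N.+1) := `|q1 Q1 P (X p)| + `|q2 Q2 P (X p)|.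
case: (arg_minP M Sp0) => pm Spm pmin.
pose ph (m : nat) (a : nat) := (1 + kap * (gpt N a - gpt N m) ^+ 2)^-1 : R.
have ph0 m a : 0 <= ph m a.
  by rewrite invr_ge0 addr_ge0// mulr_ge0 ?sqr_ge0// ltW.
have fle a b : f (X (a, b)) <= ph pm.1 a * ph pm.2 b.
  rewrite /f /ind -[`[< _ >]]/(S (a, b)); case: ifPn => Sab; last by rewrite mulr0 mulr_ge0.
  by rewrite mulr1; apply: sg_decay => //; [exact: asboolW Sab|exact: asboolW Spm|exact: pmin].
apply: (@le_trans _ _ ((N.+1%:R^-1 * \sum_(a < N.+1) ph pm.1 a) * (N.+1%:R^-1 * \sum_(b < N.+1) ph pm.2 b))).
  rewrite -mulrA ler_wpM2l ?invr_ge0// mulr_suml ler_sum// => a _.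
  rewrite mulrCA ler_wpM2l ?invr_ge0// mulr_sumr ler_sum// => b _.
have A m : N.+1%:R^-1 * \sum_(a < N.+1) ph m a <= 8 / Num.sqrt kap by exact: inv_sqr_avg_le.
have A0 m : 0 <= N.+1%:R^-1 * \sum_(a < N.+1) ph m a.
  by rewrite mulr_ge0 ?invr_ge0// sumr_ge0.
apply: (le_trans (ler_pM (A0 _) (A0 _) (A _) (A _))).
rewrite -expr2 exprMn exprVn sqr_sqrtr ?(ltW kp)// /kap le_eqVlt; apply/orP; left; apply/eqP.
by field; rewrite !gt_eqF.
Qed.

(** By convexity [om^4 <= 8 (sg^2 + ep^4)], where [ep^4 = tau^-2 <= tau^-1], and [sg^2] is summed by
    the decay estimate. The oscillating factor enters only as a weight [w] of size at most one. *)
Lemma deg4_integral_bound e : isdeg 4 e -> supp e ->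
  exists C : R, 0 <= C /\ forall P (w : 'rV[R]_n -> R), admissible P ->
  (forall x, `|w x| <= 1) ->
  nice (fun x => ev P e x * w x) ->
  `|iter_integral (fun x => ev P e x * w x)| <= C / tau P.
Proof.
move=> de se; have [C [C0 HC]] := ev_bound _ _ de.
exists (8 * C * (512 / c ^+ 2 + 1)); split.
  by rewrite mulr_ge0 ?mulr_ge0// addr_ge0// divr_ge0// sqr_ge0.
move=> P w aP w1 nf; have [t1 _] := aP.
have t0 : 0 < tau P by rewrite (lt_le_trans _ t1).
apply: ler_norm_iter_integral => // M.
have kp : 0 < Num.sqrt (tau P * (c ^+ 2 / 8)).
  by rewrite sqrtr_gt0 mulr_gt0// divr_gt0// exprn_gt0.
have [|N0 HN0] := @exists_invS_le R (Num.sqrt (tau P * (c ^+ 2 / 8)))^-1.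
  by rewrite invr_gt0.
exists (maxn M N0); first exact: leq_maxl.
have := invS_le _ _ _ HN0 (leq_maxr M N0); set N := maxn M N0.
rewrite lef_pV2 ?posrE ?ltr0Sn// => hN.
have pw x : `|ev P e x * w x| <= 8 * C * (sg P x ^+ 2 * ind x + (tau P)^-1).
  have [Kx|nKx] := pselect (cube x0 delta x); last first.
    rewrite (ev_out _ _ _ P _ _ _ _ supv se nKx) mul0r normr0.
    by rewrite /ind asboolF// mulr0 add0r mulr_ge0 ?mulr_ge0// invr_ge0 ltW.
  rewrite /ind asboolT// mulr1 normrM (@le_trans _ _ (`|ev P e x|))//.
    by rewrite ler_piMr// w1.
  apply: (le_trans (HC _ aP _ Kx)); rewrite mulrAC [leLHS]mulrC ler_wpM2r//.
  have /andP[s0 _] := sg_itv P x; have /andP[e0 e1] := ep_le1 _ aP.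
  have -> : sg P x ^+ 2 = Num.sqrt (sg P x) ^+ 4 by rewrite -{1}(sqr_sqrtr (ltW s0)) -exprM.
  have : ep P ^+ 4 <= (tau P)^-1.
    have -> : ep P ^+ 4 = (ep P ^+ 2) ^+ 2 by rewrite -exprM.
    rewrite /ep exprVn sqr_sqrtr ?(ltW t0)// expr2 ler_piMr ?invr_ge0 ?(ltW t0)//.
    by rewrite invf_le1.
  rewrite /om; set a := Num.sqrt _; set b := ep P; have a0 : 0 <= a by exact: sqrtr_ge0.
  have b0 : 0 <= b by exact: ltW.
  move=> hb; apply: (@le_trans _ _ (8 * (a ^+ 4 + b ^+ 4))); last by rewrite ler_pM2l// lerD2l.
  have h1 : (a + b) ^+ 2 <= 2 * (a ^+ 2 + b ^+ 2).
    by have := sqr_ge0 (a - b); nra.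
  have h2 : (a ^+ 2 + b ^+ 2) ^+ 2 <= 2 * (a ^+ 4 + b ^+ 4).
    have := sqr_ge0 (a ^+ 2 - b ^+ 2).
    have -> : a ^+ 4 = a ^+ 2 * a ^+ 2 by rewrite -exprD.
    have -> : b ^+ 4 = b ^+ 2 * b ^+ 2 by rewrite -exprD.
    nra.
  have -> : (a + b) ^+ 4 = ((a + b) ^+ 2) ^+ 2 by rewrite -exprM.
  have : ((a + b) ^+ 2) ^+ 2 <= (2 * (a ^+ 2 + b ^+ 2)) ^+ 2.
    by rewrite ler_pXn2r// nnegrE ?sqr_ge0// mulr_ge0// addr_ge0// sqr_ge0.
  rewrite exprMn; lra.
have rle : `|rsum N n (fun x => ev P e x * w x)| <=
    rsum N n (fun x => 8 * C * (sg P x ^+ 2 * ind x + (tau P)^-1)).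
  rewrite ler_norml; apply/andP; split.
    rewrite -mulN1r -rsumZ; apply: ler_rsum => x _; have := pw x.
    by rewrite ler_norml mulN1r => /andP[].
  by apply: ler_rsum => x _; have := pw x; rewrite ler_norml => /andP[].
apply: (le_trans rle); rewrite rsumZ rsumD -!mulrA ler_wpM2l// ler_wpM2l// mulrDl.
apply: lerD; first exact: rsum_sg2_le.
rewrite mul1r (le_trans (ler_norm _))//; apply: ler_norm_rsum => x _.
by rewrite ger0_norm// invr_ge0 ltW.
Qed.

Lemma deg0_integral_bound e : isdeg 0 e -> supp e ->
  exists C : R, 0 <= C /\ forall P (w : 'rV[R]_n -> R), admissible P ->
  (forall x, `|w x| <= 1) ->
  nice (fun x => ev P e x * w x) ->
  `|iter_integral (fun x => ev P e x * w x)| <= C.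
Proof.
move=> de se; have [C [C0 HC]] := ev_bound _ _ de; exists C; split=> // P w aP w1 nf.
apply: ler_norm_iter_integral => // M; exists M => //; apply: ler_norm_rsum => x _.
have [Kx|nKx] := pselect (cube x0 delta x); last first.
  by rewrite (ev_out _ _ _ P _ _ _ _ supv se nKx) mul0r normr0.
rewrite normrM; have := HC _ aP _ Kx; rewrite expr0 mulr1 => h.
by rewrite (le_trans _ h)// ler_piMr// w1.
Qed.

End SymbolBounds.

(** * Oscillatory integrals *)

Section Oscillation.
Context {R : realType} {n : nat}.
Variables (varpi : 'rV[R]_n -> R) (F : {mpoly R[n]}) (d : nat) (j : 'I_n).
Variables (x0 : 'rV[R]_n) (delta : R).
Hypothesis hF : F \is d.-homog.
Hypothesis sv : smooth varpi.
Hypothesis supv : fsupport varpi `<=` cube x0 delta.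
Hypothesis Ku : cube x0 delta `<=` ucube.
Implicit Types (x : 'rV[R]_n) (P : @par R n) (e : @sym R n) (t : 'I_n -> R).

(** Normalised so that, by Euler's identity, [tau * radial + sum_k t_k] is the Euler derivative of
    the phase; [axial] does the same for [x_j d/dx_j] and [t_j]. *)
Definition radial : {mpoly R[n]} := (2 * pi * d%:R) *: F.
Definition axial : {mpoly R[n]} := (2 * pi) *: logderiv j F.

Local Notation ev := (ev varpi radial axial).

Definition phase (ta : R) t x : R :=
  2 * pi * ta * F.@[x ord0] + \sum_k t k * ln (x ord0 k).

Lemma phase_continuous ta t th x : ucube x ->
  {for x, continuous (fun x => phase ta t x + th)}.
Proof.
move=> xu; apply: contD; last exact: contC.
apply: contD; first by apply: contM; [exact: contC|exact: continuous_meval].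
apply: cont_sum => k; apply: contM; first exact: contC.
apply: cont_comp; first exact: coord_continuous.
by apply: continuous_ln; have /andP[] := xu k.
Qed.

Lemma is_derive_phase ta t k x : ucube x ->
  is_derive (x ord0 k) (1 : R) (fun y : R => phase ta t (upd x k y))
    (2 * pi * ta * F^`M(k).@[x ord0] + t k / x ord0 k).
Proof.
move=> xu; apply: der_add; last exact: is_derive_logsum.
have := der_mul _ _ _ _ _ (der_cst (x ord0 k) (2 * pi * ta)) (is_derive_meval F k x).
by move/is_derive_eq; apply; rewrite mul0r add0r.
Qed.

Lemma nice_ev P e (w : 'rV[R]_n -> R) : supp e ->
  (forall x, ucube x -> {for x, continuous w}) -> nice (fun x => ev P e x * w x).
Proof.
move=> se wc; apply: (nice_cube x0 delta) => // x.
  by move=> xu; apply: contM; [exact: ev_continuous|exact: wc].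
by move=> nKx; rewrite (ev_out _ _ _ P _ _ _ _ supv se nKx) mul0r.
Qed.

Lemma nice_ev_cos P e ta t th : supp e ->
  nice (fun x => ev P e x * cos (phase ta t x + th)).
Proof.
move=> se; apply: nice_ev => // x xu.
by apply: cont_comp; [exact: phase_continuous|exact: continuous_cos].
Qed.

(** The coefficient of [x_k d/dx_k] in the field [sg (q1 E + q2 x_j d/dx_j)], without its factor
    [ep]. *)
Definition uk k : @sym R n := if k == j then Add Ga Gb else Ga.

Definition flux e k := Mul e (uk k).

(** The divergence of [e] times the field, by [d/dx_k (ep x_k u_k e) = ep x_k d/dx_k (u_k e) + ep
    u_k e]. *)
Definition transport e : @sym R n :=
  Sum (fun k => Add (dk radial axial k (flux e k)) (Mul Ep (flux e k))).

Lemma deg_flux m e k : isdeg m e -> isdeg m.+1 (flux e k).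
Proof.
move=> de; rewrite -addn1; apply: deg_Mul => //; rewrite /uk.
by case: eqP => _; repeat constructor.
Qed.

Lemma deg_transport m e : isdeg m e -> isdeg m.+2 (transport e).
Proof.
move=> de; apply: deg_Sum => k; apply: deg_Add.
  by apply: deg_dk; exact: deg_flux.
by apply: (deg_Mul 1 m.+1); [constructor|exact: deg_flux].
Qed.

Lemma supp_flux e k : supp e -> supp (flux e k).
Proof. by move=> se; rewrite /= se. Qed.

Lemma supp_transport_term e k : supp e ->
  supp (Add (dk radial axial k (flux e k)) (Mul Ep (flux e k))).
Proof.
move=> se; have sf := supp_flux e k se.
change (is_true (supp (dk radial axial k (flux e k)) && supp (flux e k))).
by rewrite supp_dk.
Qed.

Lemma supp_transport e : supp e -> supp (transport e).
Proof. by move=> se; apply/forallP => k; exact: supp_transport_term. Qed.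

(** The shift [th] lets one family cover sines and cosines, as [sin y = cos (y - pi / 2)]. *)
Definition osc P t th e := iter_integral (fun x => ev P e x * cos (phase (tau P) t x + th)).

(** The two fields applied to the phase give [q1 / ep] and [q2 / ep], so the combination is
    [(q1^2 + q2^2) sg], which is [1 - sg] by the choice of [sg]. *)
Lemma flux_phase P t x : T1 P = \sum_k t k -> T2 P = t j ->
  \sum_k ep P * ev P (uk k) x * (2 * pi * tau P * (logderiv k F).@[x ord0] + t k) =
  1 - sg radial axial P x.
Proof.
move=> hT1 hT2.
pose phi k := 2 * pi * tau P * (logderiv k F).@[x ord0] + t k.
have S1 : \sum_k phi k = tau P * radial.@[x ord0] + T1 P.
  rewrite big_split/= hT1 -mulr_sumr; congr (_ + _).
  have /(congr1 (meval (x ord0))) := euler _ _ hF; rewrite raddf_sum /= => ->.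
  by rewrite !mevalZ; ring.
have S2 : phi j = tau P * axial.@[x ord0] + T2 P by rewrite hT2 mevalZ /phi; ring.
have -> : \sum_k ep P * ev P (uk k) x * phi k =
    ep P * (ev P Ga x * (\sum_k phi k) + ev P Gb x * phi j).
  rewrite mulrDr mulrA mulr_sumr (bigD1 j)//= [in RHS](bigD1 j)//= /uk eqxx /=.
  rewrite (eq_bigr (fun k => ep P * (q1 radial P x * sg radial axial P x) * phi k)).
    by ring.
  by move=> k /negbTE ->.
rewrite S1 S2 /=.
set s := sg _ _ _ _.
have -> : ep P * (q1 radial P x * s * (tau P * radial.@[x ord0] + T1 P) +
   q2 axial P x * s * (tau P * axial.@[x ord0] + T2 P)) =
   (q1 radial P x ^+ 2 + q2 axial P x ^+ 2) * s by rewrite /q1 /q2; ring.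
have := sg_den_gt0 radial axial P x; rewrite /s /sg; set a := q1 _ _ _; set b := q2 _ _ _ => ab.
by field; rewrite gt_eqF.
Qed.

(* Integration by parts along the field [sum_k ep u_k x_k d/dx_k], for which
   the derivative of the phase is [1 - sg]. *)
Lemma osc_step P t th e : 0 < tau P -> T1 P = \sum_k t k -> T2 P = t j -> supp e ->
  osc P t th e = osc P t th (Mul Sg e) - osc P t (th - pi / 2) (transport e).
Proof.
move=> t0 hT1 hT2 se.
pose phi k x := 2 * pi * tau P * (logderiv k F).@[x ord0] + t k.
(* [g k] is the [k]-th partial derivative of [x_k ep u_k e sin (phase + th)], with the sine written
   as a shifted cosine. *)
pose g k x := ev P (Add (dk radial axial k (flux e k)) (Mul Ep (flux e k))) x *
   cos (phase (tau P) t x + (th - pi / 2)) +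
   ev P (flux e k) x * (ep P * phi k x * cos (phase (tau P) t x + th)).
have ng k : nice (g k).
  apply: niceD.
    by apply: nice_ev_cos; exact: supp_transport_term.
  apply: nice_ev; first exact: supp_flux.
  move=> x xu; apply: contM; last first.
    by apply: cont_comp; [exact: phase_continuous|exact: continuous_cos].
  apply: contM; first exact: contC.
  apply: contD; last exact: contC.
  by apply: contM; [exact: contC|exact: continuous_meval].
have int0 k : iter_integral (g k) = 0.
  apply: (iter_integral_partial k (fun x => ev P (flux e k) x *
    (x ord0 k * ep P * sin (phase (tau P) t x + th)))) => //.
    apply: nice_ev; first exact: supp_flux.
    move=> x xu; apply: contM; last first.
      by apply: cont_comp; [exact: phase_continuous|exact: continuous_sin].
    by apply: contM; [exact: coord_continuous|exact: contC].
  move=> x xu; have xk : x ord0 k != 0 by have /andP[/gt_eqF ->] := xu k.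
  have e0 : ep P != 0 by rewrite gt_eqF// ep_gt0.
  under eq_fun do rewrite updE.
  have D1 := is_derive_ev varpi radial axial P t0 (flux e k) k x sv xu.
  have D2 := der_comp _ _ _ _ _ (der_add _ _ _ _ _ (is_derive_phase (tau P) t k x xu)
    (der_cst (x ord0 k) th)) (is_derive_sin _).
  have D3 := der_mul _ _ _ _ _ (der_id (x ord0 k)) (der_cst (x ord0 k) (ep P)).
  have := der_mul _ _ _ _ _ D1 (der_mul _ _ _ _ _ D3 D2).
  rewrite !upd_id; move/is_derive_eq; apply.
  rewrite /g addrA cosBpihalf /phi /logderiv mevalM mevalXU.
  set A := ev P (flux e k) x; set A' := ev P (dk _ _ _ _) x.
  have -> : ev P (Add (dk radial axial k (flux e k)) (Mul Ep (flux e k))) x = A' + ep P * A by [].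
  set sn := sin _; set cs := cos _.
  by field; rewrite e0 xk.
have : iter_integral (fun x => \sum_k g k x) = 0.
  by rewrite iter_integral_sum// big1.
(* Summed over [k], the phase terms collapse to [(1 - sg) e cos (phase + th)], which splits into the
   wanted integrand and the one carrying [sg]. *)
have -> : (fun x => \sum_k g k x) =
    (fun x => (ev P (transport e) x * cos (phase (tau P) t x + (th - pi / 2)) +
       ev P e x * cos (phase (tau P) t x + th)) +
      (-1) * (ev P (Mul Sg e) x * cos (phase (tau P) t x + th))).
  apply/funext => x; rewrite big_split -[RHS]addrA; congr (_ + _).
    by rewrite mulr_suml.
  rewrite (eq_bigr (fun k => ep P * ev P (uk k) x * phi k x * (ev P e x * cos (phase (tau P) t x + th)))); last first.
    by move=> k _; rewrite -[ev P (flux e k) x]/(ev P e x * ev P (uk k) x); ring.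
  by rewrite -mulr_suml flux_phase// -[ev P (Mul Sg e) x]/(sg radial axial P x * ev P e x); ring.
rewrite iter_integralD; last 2 first.
- by apply: niceD; apply: nice_ev_cos => //; exact: supp_transport.
- by apply: niceZ; apply: nice_ev_cos; rewrite /= se.
rewrite iter_integralZ; last by apply: nice_ev_cos; rewrite /= se.
rewrite iter_integralD; last 2 first.
- by apply: nice_ev_cos => //; exact: supp_transport.
- exact: nice_ev_cos.
rewrite -/(osc P t th e) -/(osc P t th (Mul Sg e)) -/(osc P t (th - pi / 2) (transport e)).
lra.
Qed.

(** Each step raises the degree by two in both of its terms, so an amplitude of degree zero leaves
    four terms of degree four. *)
Lemma osc_two_steps P t th e : 0 < tau P -> T1 P = \sum_k t k -> T2 P = t j -> supp e ->
  osc P t th e = osc P t th (Mul Sg (Mul Sg e))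
    - osc P t (th - pi / 2) (transport (Mul Sg e))
    - osc P t (th - pi / 2) (Mul Sg (transport e))
    + osc P t (th - pi / 2 - pi / 2) (transport (transport e)).
Proof.
move=> t0 hT1 hT2 se; rewrite (osc_step _ _ th e)//.
rewrite (osc_step _ _ th (Mul Sg e))//.
rewrite (osc_step _ _ (th - pi / 2) (transport e))//; last exact: supp_transport.
ring.
Qed.

End Oscillation.

(** * Real and imaginary parts of the integrand *)

Section ComplexExponential.
Context {R : realType}.

Lemma cexpD (z w : R[i]) : cexp (z + w) = cexp z * cexp w.
Proof.
case: z w => [a b] [c e]; rewrite /cexp /= expRD cosD sinD.
by apply/eqP; rewrite eq_complex /=; apply/andP; split; apply/eqP; ring.
Qed.

Lemma cexp0 : cexp (0 : R[i]) = 1.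
Proof. by rewrite /cexp /= expR0 cos0 sin0 mul1r. Qed.

Lemma prod_cpow n (x r t : 'I_n -> R) :
  \prod_(k < n) cpow (x k) (r k +i* t k) =
  cexp ((\sum_k r k * ln (x k)) +i* (\sum_k t k * ln (x k))).
Proof.
elim/big_rec3: _ => [|k y b a _ ->]; first by rewrite -cexp0.
rewrite /cpow -cexpD; congr cexp.
by apply/eqP; rewrite eq_complex /=; apply/andP; split; apply/eqP; ring.
Qed.

Lemma oscillatory_integrandE n (F : {mpoly R[n]}) varpi (ta : R) (r t : 'I_n -> R) x :
  oscillatory_integrand F varpi ta r t x =
  (varpi x * expR (\sum_k r k * ln (x ord0 k)) * cos (phase F ta t x)) +i*
  (varpi x * expR (\sum_k r k * ln (x ord0 k)) * sin (phase F ta t x)).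
Proof.
rewrite /oscillatory_integrand prod_cpow -mulrA -cexpD /cexp /phase.
apply/eqP; rewrite eq_complex /=.
rewrite !(mulr0, mul0r, mulr1, subr0, addr0, add0r).
by rewrite [2 * pi * ta * _ + _]addrC !mulrA !eqxx.
Qed.

Lemma norm_complex_le (a b c : R) : `|a| <= c -> `|b| <= c ->
  `|a +i* b| <= (2 * c)%:C.
Proof.
move=> ac bc; rewrite normc_def /= lecR.
have c0 : 0 <= c by rewrite (le_trans _ ac).
rewrite -[leRHS](@ger0_norm _ (2 * c)) ?mulr_ge0// -sqrtr_sqr ler_wsqrtr//.
rewrite -[a ^+ 2]real_normK ?num_real// -[b ^+ 2]real_normK ?num_real//.
have : `|a| ^+ 2 <= c ^+ 2 by rewrite ler_pXn2r// nnegrE.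
have : `|b| ^+ 2 <= c ^+ 2 by rewrite ler_pXn2r// nnegrE.
by have := sqr_ge0 c; rewrite exprMn; lra.
Qed.

End ComplexExponential.

(** * Choice of the radius and the final estimate *)

Lemma ucube_margin (R : realType) n (x0 : 'rV[R]_n) : ucube x0 ->
  exists2 m : R, 0 < m & forall k, 2 * m <= x0 ord0 k /\ 2 * m <= 1 - x0 ord0 k.
Proof.
move=> x01; pose f k := x0 ord0 k * (1 - x0 ord0 k).
have f01 k : 0 < f k <= 1.
  by have := x01 k; rewrite /f => /andP[? ?]; apply/andP; split; nra.
(* All factors lie in []0, 1]], so their product is below each of them; it serves as a common lower
   bound and also makes sense for an empty index set. *)
exists ((\prod_k f k) / 2).
  by rewrite divr_gt0// prodr_gt0// => k _; have /andP[] := f01 k.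
move=> k; have -> : 2 * (\prod_k f k / 2) = \prod_k f k by field.
have le_f : \prod_k f k <= f k.
  rewrite (bigD1 k)//= ger_pMr; last by have /andP[] := f01 k.
  by apply: prodr_ile1 => l _; have /andP[/ltW -> ->] := f01 l.
have := x01 k => /andP[? ?].
by split; apply: (le_trans le_f); rewrite /f; nra.
Qed.

Lemma phaseN (R : realType) n (F : {mpoly R[n]}) (ta : R) (t : 'I_n -> R) x :
  phase F (- ta) (fun k => - t k) x = - phase F ta t x.
Proof.
rewrite /phase opprD -sumrN; congr (_ + _); first by ring.
by apply: eq_bigr => k _; rewrite mulNr.
Qed.

Theorem theorem1p1 (R : realType) (n d : nat) (F : {mpoly R[n]})
    (hd : (1 < d)%N)
    (hF : F \is d.-homog)
    (hdim : (4%:E < (n%:R)%:E - affine_dim (singular_locus F))%E)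
    (theta theta' : 'I_n -> R)
    (htheta : forall j, theta j <= theta' j)
    (x0 : 'rV[R]_n)
    (hx0 : forall j, 0 < x0 ord0 j < 1)
    (hFx0 : F.@[x0 ord0] = 0)
    (hns : exists j, F^`M(j).@[x0 ord0] != 0) :
  exists2 delta1 : R, 0 < delta1 &
    forall delta0 : R, 0 < delta0 <= delta1 ->
    forall varpi : 'rV[R]_n -> R,
      smooth varpi -> fsupport varpi `<=` cube x0 delta0 ->
    exists2 C : R, 0 < C &
      forall (tau : R) (r t : 'I_n -> R),
        (forall j, theta j <= r j <= theta' j) ->
        `|iter_cintegral (oscillatory_integrand F varpi tau r t)|
          <= (C * min1inv tau)%:C.
Proof.
have [j hj] := hns.
have d0 : (0 < d)%N by exact: ltnW.
have xj : 0 < x0 ord0 j by have /andP[] := hx0 j.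
have [k kj hk] := exists_minor d F j x0 d0 hF xj hFx0 hj.
pose Q1 := radial F d; pose Q2 := axial F j.
(* The scalars in [radial] and [axial] are nonzero, so the nonzero minor of [F] and [logderiv j F]
   carries over. *)
have hdet : Q1^`M(j).@[x0 ord0] * Q2^`M(k).@[x0 ord0] -
    Q1^`M(k).@[x0 ord0] * Q2^`M(j).@[x0 ord0] != 0.
  rewrite /Q1 /Q2 /radial /axial !mderivZ !mevalZ.
  set u := _.@[_] in hk *; set v := _.@[_] in hk *; set w := _.@[_] in hk *; set z := _.@[_] in hk *.
  have -> : 2 * pi * d%:R * u * (2 * pi * v) - 2 * pi * d%:R * w * (2 * pi * z) =
    (2 * pi * d%:R) * (2 * pi) * (u * v - w * z) by ring.
  by rewrite !mulf_neq0// ?gt_eqF ?pi_gt0 ?ltr0n.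
have [c c0 [h h0 bil]] := bilipschitz Q1 Q2 j k x0 kj hdet.
have [m m0 hm] := ucube_margin R n x0 hx0.
(* Radius [h] serves the bi-Lipschitz bound; radius [m], half the margin, keeps all coordinates in
   [[m, 1 - m]], away from the singularity of the logarithm. *)
exists (Num.min h m); first by rewrite lt_min h0.
move=> delta0 /andP[dl0]; rewrite le_min => /andP[dh dm] varpi sv supv.
have Kl x : cube x0 delta0 x -> forall l, m <= x ord0 l < 1.
  move=> Kx l; have [m1 m2] := hm l; have := Kx l; rewrite ler_norml => /andP[? ?].
  by apply/andP; split; lra.
have Ku := cube_ucube x0 delta0 m m0 Kl.
pose B := \sum_l (`|theta l| + `|theta' l|).
have B0 : 0 <= B by apply: sumr_ge0 => l _; rewrite addr_ge0.
have rB (r : 'I_n -> R) : (forall l, theta l <= r l <= theta' l) -> forall l, `|r l| <= B.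
  move=> hr l; rewrite /B (bigD1 l)//= (@le_trans _ _ (`|theta l| + `|theta' l|))//.
    have /andP[h1 h2] := hr l; rewrite ler_norml.
    have := ler_norm (theta' l); have := ler_norm (- theta l); rewrite normrN.
    have : 0 <= `|theta l| by []; have : 0 <= `|theta' l| by [].
    by move=> *; apply/andP; split; lra.
  by rewrite lerDl sumr_ge0// => i _; rewrite addr_ge0.
have bil0 x (a b a' b' : R) : near_by delta0 (upd (upd x j a) k b) x0 ->
    near_by delta0 (upd (upd x j a') k b') x0 ->
    c * (`|a - a'| + `|b - b'|) <=
    `|Q1.@[(upd (upd x j a) k b) ord0] - Q1.@[(upd (upd x j a') k b') ord0]| +
    `|Q2.@[(upd (upd x j a) k b) ord0] - Q2.@[(upd (upd x j a') k b') ord0]|.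
  by move=> h1 h2; apply: bil => l; [exact: le_trans (h1 l) dh|exact: le_trans (h2 l) dh].
(* The empty list of derivatives gives [varpi] itself, so [e0] is the full amplitude [varpi x^r]. *)
pose e0 : @sym R n := Mul (Vp [::]) Mo.
have deg0 : isdeg 0 e0 by apply: (deg_Mul 0 0); constructor.
have s0 : supp e0 by [].
pose tr := transport F d j.
have bd4 := deg4_integral_bound varpi Q1 Q2 x0 delta0 sv supv m m0 Kl B B0 j k c c0 bil0.
have degS i (e : @sym R n) : isdeg i e -> isdeg i.+2 (Mul Sg e).
  by move=> de; apply: (deg_Mul 2 i) => //; constructor.
have degT i e : isdeg i e -> isdeg i.+2 (tr e) by exact: deg_transport.
have supT e : supp e -> supp (tr e) by exact: supp_transport.
have [C1 [C10 H1]] := bd4 (Mul Sg (Mul Sg e0)) (degS _ _ (degS _ _ deg0)) s0.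
have [C2 [C20 H2]] := bd4 (tr (Mul Sg e0)) (degT _ _ (degS _ _ deg0)) (supT (Mul Sg e0) s0).
have [C3 [C30 H3]] := bd4 (Mul Sg (tr e0)) (degS _ _ (degT _ _ deg0)) (supT e0 s0).
have [C4 [C40 H4]] := bd4 (tr (tr e0)) (degT _ _ (degT _ _ deg0)) (supT _ (supT e0 s0)).
have [C5 [C50 H5]] := deg0_integral_bound varpi Q1 Q2 x0 delta0 sv supv m m0 Kl B B0 e0 deg0 s0.
pose C := C1 + C2 + C3 + C4 + C5 + 1.
have C0 : 0 < C by rewrite /C; lra.
have nc := nice_ev_cos varpi F d j x0 delta0 sv supv Ku.
have cos1 (y : R) : `|cos y| <= 1 by rewrite ler_norml cos_geN1 cos_le1.
pose I ta (r t : 'I_n -> R) th := iter_integral (fun x : 'rV[R]_n =>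
  varpi x * expR (\sum_l r l * ln (x ord0 l)) * cos (phase F ta t x + th)).
have small ta r t th : (forall l, theta l <= r l <= theta' l) -> `|I ta r t th| <= C.
  move=> hr; apply: (@le_trans _ _ C5); last by rewrite /C; lra.
  (* The value of [e0] involves only [rr], so the other parameters can be any admissible ones; the
     actual phase sits in the weight. *)
  apply: (H5 (Par 1 0 0 r)); first by split=> //; exact: rB.
    by move=> x; exact: cos1.
  exact: (nc (Par 1 0 0 r) e0 ta t th s0).
have big ta r t th : 1 <= ta -> (forall l, theta l <= r l <= theta' l) ->
    `|I ta r t th| <= C / ta.
  move=> ta1 hr; have ta0 : 0 < ta by rewrite (lt_le_trans _ ta1).
  pose P := Par ta (\sum_l t l) (t j) r.
  have aP : admissible B P by split=> //; exact: rB.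
  have := osc_two_steps varpi F d j x0 delta0 hF sv supv Ku P t th e0 ta0 erefl erefl s0.
  rewrite -[osc _ _ _ _ _ _ _ e0]/(I ta r t th) => ->.
  have b1 := H1 P _ aP (fun x => cos1 _) (nc P (Mul Sg (Mul Sg e0)) ta t th s0).
  have b2 := H2 P _ aP (fun x => cos1 _)
    (nc P (tr (Mul Sg e0)) ta t (th - pi / 2) (supT (Mul Sg e0) s0)).
  have b3 := H3 P _ aP (fun x => cos1 _)
    (nc P (Mul Sg (tr e0)) ta t (th - pi / 2) (supT e0 s0)).
  have b4 := H4 P _ aP (fun x => cos1 _)
    (nc P (tr (tr e0)) ta t (th - pi / 2 - pi / 2) (supT _ (supT e0 s0))).
  rewrite (le_trans (ler_normD _ _))//.
  apply: (le_trans (lerD (le_trans (ler_normB _ _) (lerD (le_trans (ler_normB _ _) (lerD b1 b2)) b3)) b4)).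
  by rewrite -!mulrDl ler_pM2r ?invr_gt0// /C; lra.
have bound ta r t th : (forall l, theta l <= r l <= theta' l) ->
    `|I ta r t th| <= C * min1inv ta.
  move=> hr; rewrite /min1inv; case: eqP => [_|/eqP ta0]; first by rewrite mulr1; exact: small.
  have na0 : 0 < `|ta| by rewrite normr_gt0.
  have [ta1|ta1] := leP `|ta| 1.
    by rewrite min_l ?mulr1 ?invf_ge1//; exact: small.
  rewrite min_r ?invf_le1 ?(ltW ta1)//.
  have [tap|tan] := leP 0 ta.
    by rewrite (ger0_norm tap) in ta1 *; apply: big => //; exact: ltW.
  rewrite (ltr0_norm tan) in ta1 *.
  (* Since the cosine is even, negative [tau] reduces to positive [tau] by changing the signs of
     [tau], [t] and [th] together; uniformity in [t] and [th] makes this harmless. *)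
  have -> : I ta r t th = I (- ta) r (fun l => - t l) (- th).
    congr iter_integral; apply/funext => x.
    by rewrite phaseN -opprD cosN.
  by apply: big => //; exact: ltW.
(* The factor [2] pays for bounding the real and imaginary parts separately, with shifts [0] and
   [- pi / 2]. *)
exists (2 * C); first by rewrite mulr_gt0.
move=> ta r t hr; rewrite -mulrA; apply: norm_complex_le.
- have -> : (fun x => complex.Re (oscillatory_integrand F varpi ta r t x)) =
    (fun x => varpi x * expR (\sum_l r l * ln (x ord0 l)) * cos (phase F ta t x + 0)).
    by apply/funext => x; rewrite oscillatory_integrandE addr0.
  exact: bound.
- have -> : (fun x => complex.Im (oscillatory_integrand F varpi ta r t x)) =
    (fun x => varpi x * expR (\sum_l r l * ln (x ord0 l)) * cos (phase F ta t x - pi / 2)).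
    by apply/funext => x; rewrite oscillatory_integrandE cosBpihalf.
  exact: bound.
Qed.
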